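(* Let $\Delta$ be a disk diagram with $V^\circ(\Delta)\neq\varnothing$ and all face lengths at most $L_{\max}$. For every basepoint $b\in V(\partial\Delta)$ the following hold. (i) $\mathrm{FL}_b(\Delta)\cdot\operatorname{Area}(\Delta)\ge c/\lambda_1(\Delta)$, where $c=c(L_{\max})>0$ depends only on $L_{\max}$. (No minimality or vertex degree hypothesis is assumed.) (ii) If moreover $\Delta$ is an area-minimising van Kampen diagram over a finite presentation $\mathcal P$ (with $L_{\max}$ its longest relator length) with Dehn function $\delta_{\mathcal P}$, then $\mathrm{FL}_b(\Delta)\cdot\delta_{\mathcal P}(\mathrm{FL}_b(\Delta))\ge c/\lambda_1(\Delta)$ with the same $c$. If $\delta_{\mathcal P}(n)\le Kn^\alpha$ for all integers $n\ge 1$ and some $\alpha\ge 1$, this gives $\mathrm{FL}_b(\Delta)\ge C\lambda_1(\Delta)^{-1/(\alpha+1)}$, where $C=C(K,L_{\max},\alpha)>0$. (iii) Under the hypotheses of (ii) (that is, $\Delta$ is an area-minimising van Kampen diagram over the finite presentation $\mathcal P$), if in addition $\delta_{\mathcal P}(n)\le Kn^\alpha$ for all integers $n\ge 1$ and some $\alpha>1$, then $\mathrm{FL}_b(\Delta)\ge C\lambda_1(\Delta)^{-1/(2\alpha-2)}$, where $C=C(K,L_{\max},\alpha)>0$. (No vertex degree bound is assumed.)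
   Context: A disk diagram $\Delta$ is a finite, connected, simply connected planar $2$-complex (embedded in the plane); its $1$-skeleton may have multi-edges but no loop edges. $\operatorname{Area}(\Delta)$ is the number of $2$-cells; $\partial\Delta$ is the boundary walk (closed edge-walk, possibly revisiting vertices), $|\partial\Delta|$ its length, $V^\circ=V(\Delta)\setminus V(\partial\Delta)$. $\deg(v)$ counts edge incidences with multiplicity. The length of a face is its boundary length. $\lambda_1(\Delta)=\inf_{f\not\equiv0}\dfrac{\sum_{e\in E(\Delta)}(\widetilde f(e^+)-\widetilde f(e^-))^2}{\sum_{v\in V^\circ}\deg(v)f(v)^2}$ over $f:V^\circ\to\mathbb R$, with $\widetilde f$ the extension by $0$ to $V(\partial\Delta)$. Based filling length: for $b\in V(\partial\Delta)$, a based shelling is a sequence $\Delta=\Sigma_0\supset\Sigma_1\supset\cdots\supset\Sigma_N=\{b\}$ of finite connected simply connected planar subcomplexes, each step removing a boundary $2$-cell or a boundary spur (a degree-$1$ vertex and its incident edge), with $b\in V(\partial\Sigma_j)$ for all $j$. When a boundary $2$-cell $\sigma$ meeting the current boundary in a connected arc of length $k$ is removed, that arc of the boundary walk is replaced by the complementary arc of $\partial\sigma$ (of length $|\partial\sigma|-k$), and isolated edges or vertices not containing the basepoint are deleted; if the last remaining $2$-cell has its whole boundary on the current boundary, removing it terminates the shelling. $|\partial\Sigma_j|$ is the length of the boundary walk of $\Sigma_j$ (the empty walk has length $0$). $\mathrm{FL}_b(\Delta)=\inf\max_{0\le j\le N}|\partial\Sigma_j|$, the infimum over based shellings. For presentations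 $\mathcal P=\langle S\mid R\rangle$: $R\neq\varnothing$ is finite and all relators are cyclically reduced of length at least $2$. A van Kampen diagram for a word $w$ is a labelled disk diagram whose faces read cyclic conjugates of relators or their inverses and whose boundary walk reads $w$; it is area-minimising if its area equals $\operatorname{Area}^{\min}_{\mathcal P}(w)$, the minimum over all diagrams for $w$. $\delta_{\mathcal P}(n)=\max\{\operatorname{Area}^{\min}_{\mathcal P}(w): w=_{G(\mathcal P)}1,\ |w|\le n,\ w\text{ cyclically reduced}\}$. *)

(* Defs.v *)
From mathcomp Require Import all_boot all_order all_algebra.
From mathcomp Require Import all_classical all_reals all_analysis.

Set Implicit Arguments.
Unset Strict Implicit.
Unset Printing Implicit Defensive.

Import Order.TTheory GRing.Theory Num.Theory.

(* An edge e carries the two darts (oriented edges) (e, true) and (e, false). *)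
Definition opp_dart (E : Type) (d : E * bool) : E * bool := (d.1, ~~ d.2).

(* A disk diagram is encoded as a combinatorial map on the sphere.
   - [lface d] is the face on the left of the dart d; [None] is the unbounded
     region of the plane, so [dface] is the type of the 2-cells.
   - [fsucc d] is the dart following d along the boundary of the region on its
     left.  Its cycles are the boundary walks of the regions (which need not be
     simple closed curves), and the cycles of [fsucc \o opp_dart] turn around a
     vertex.
   - A connected map has Euler characteristic at most 2, with equality exactly
     on the sphere.  Counting the unbounded region, [dd_euler] is therefore
     planarity; as every other region is a 2-cell, it is also simple
     connectedness.
   The one-vertex diagram, with no edge and no 2-cell, is allowed. *)
Record disk_diagram := DiskDiagram {
  vert : finType;
  edge : finType;
  dface : finType;
  src : edge * bool -> vert;
  fsucc : edge * bool -> edge * bool;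
  lface : edge * bool -> option dface;
  dd_fsucc_inj : injective fsucc;
  dd_vertP : forall d d' : edge * bool,
    src d = src d' <-> fconnect (fun x => fsucc (opp_dart x)) d d';
  dd_faceP : forall d d' : edge * bool,
    lface d = lface d' <-> fconnect fsucc d d';
  dd_face_surj : forall s : dface, exists d, lface d = Some s;
  dd_outer : (0 < #|edge|)%N -> exists d, lface d = None;
  dd_connected : forall u v : vert,
    connect (fun x y => [exists d, (src d == x) && (src (opp_dart d) == y)]) u v;
  dd_noloop : forall d, src d != src (opp_dart d);
  dd_euler : (#|vert| + #|dface| = #|edge| + 1)%N
}.

Definition dart (D : disk_diagram) : finType := (edge D * bool)%type.

Definition area (D : disk_diagram) : nat := #|dface D|.

Definition deg (D : disk_diagram) (v : vert D) : nat :=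
  #|[set d : dart D | src d == v]|.

Definition face_length (D : disk_diagram) (s : dface D) : nat :=
  #|[set d : dart D | lface d == Some s]|.

Record subcx (D : disk_diagram) := Subcx {
  sverts : {set vert D};
  sedges : {set edge D};
  sfaces : {set dface D}
}.

Definition full_subcx (D : disk_diagram) : subcx D :=
  Subcx [set: vert D] [set: edge D] [set: dface D].

Definition point_subcx (D : disk_diagram) (b : vert D) : subcx D :=
  Subcx [set b] finset.set0 finset.set0.

Section Subcomplexes.
Variable D : disk_diagram.
Implicit Types (S T : subcx D) (v b : vert D) (d : dart D) (s : dface D).

Definition subcx_closed S : Prop :=
  (forall d, d.1 \in sedges S -> src d \in sverts S) /\
  (forall d s, lface d = Some s -> s \in sfaces S -> d.1 \in sedges S).

Definition subcx_connected S : Prop :=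
  {in sverts S &, forall u v,
    connect (fun x y => [exists d : dart D,
      [&& d.1 \in sedges S, src d == x & src (opp_dart d) == y]]) u v}.

(* A connected planar 2-complex has b_0 = 1 and b_2 = 0, and it is simply
   connected iff b_1 = 0, i.e. iff its Euler characteristic is 1. *)
Definition subcx_disk S : Prop :=
  [/\ subcx_closed S, subcx_connected S
    & (#|sverts S| + #|sfaces S| = #|sedges S| + 1)%N].

(* The region on the left of d is outside S. *)
Definition bdart S d : bool :=
  (d.1 \in sedges S) &&
  (if lface d is Some s then s \notin sfaces S else true).

(* The boundary walk of a connected simply connected S runs exactly once along
   each edge side facing the outside of S (so twice along an edge lying on no
   2-cell of S), and is empty if S is a point. *)
Definition perimeter S : nat := #|[set d : dart D | bdart S d]|.

(* The second alternative is the case where S is reduced to the point v. *)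
Definition bvert S v : bool :=
  (v \in sverts S) &&
  ([exists d : dart D, bdart S d && (src d == v)] ||
   [forall d : dart D, (d.1 \in sedges S) ==> (src d != v)]).

Definition spur_step S T : Prop :=
  exists d : dart D,
    [/\ d.1 \in sedges S,
        forall d' : dart D, d'.1 \in sedges S -> src d' = src d -> d' = d,
        sverts T = sverts S :\ src d,
        sedges T = sedges S :\ d.1
      & sfaces T = sfaces S].

(* The removed arc consists of the k consecutive darts of the boundary of s that
   start at d; the reversed darts lie on the boundary walk of S.  The arc is not
   required to be the longest possible one: when the whole intersection of s
   with the boundary is an arc that can be removed, removing less of it never
   gives shorter boundary walks, and allowing this makes sure that based
   shellings exist for every diagram and basepoint, also when no 2-cell meets the
   boundary in one arc avoiding b in its interior.
   The last 2-cell, when S is its closure, is removed with k = |boundary of s|,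
   leaving b alone. *)
Definition face_step b S T : Prop :=
  exists s (d : dart D) (k : nat),
    let arc := traject (@fsucc D) d k in
    [/\ s \in sfaces S,
        (0 < k)%N,
        {in arc, forall d', lface d' = Some s /\ bdart S (opp_dart d')},
        sfaces T = sfaces S :\ s
      & sedges T = [set e in sedges S | e \notin [seq d'.1 | d' <- arc]] /\
        sverts T = [set v in sverts S |
          (v == b) || [exists d' : dart D, (d'.1 \in sedges T) && (src d' == v)]]].

Definition based_shelling b (N : nat) (Sg : nat -> subcx D) : Prop :=
  [/\ Sg 0%N = full_subcx D,
      Sg N = point_subcx b,
      forall j, (j <= N)%N -> subcx_disk (Sg j) /\ bvert (Sg j) b
    & forall j, (j < N)%N ->
        spur_step (Sg j) (Sg j.+1) \/ face_step b (Sg j) (Sg j.+1)].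

(* Infimum in nat of a nonempty set, i.e. its minimum; the default value 0 is
   never used. *)
Definition filling_length b : nat :=
  infimum 0%N [set m : nat | exists (N : nat) (Sg : nat -> subcx D),
    based_shelling b N Sg /\ m = (\max_(j < N.+1) perimeter (Sg j))%N]%classic.

End Subcomplexes.

Definition bd_vertex (D : disk_diagram) (v : vert D) : bool :=
  bvert (full_subcx D) v.

Definition int_vertices (D : disk_diagram) : {set vert D} :=
  [set v | ~~ bd_vertex v].

Section Eigenvalue.
Variables (R : realType) (D : disk_diagram).
Local Open Scope ring_scope.

Definition dirichlet_energy (f : vert D -> R) : R :=
  \sum_(e : edge D) (f (src (e, true)) - f (src (e, false))) ^+ 2.

Definition weighted_mass (f : vert D -> R) : R :=
  \sum_(v in int_vertices D) (deg v)%:R * f v ^+ 2.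

(* f is the extension by 0 of a nonzero function on the interior vertices. *)
Definition lambda1 : R :=
  inf [set q : R | exists f : vert D -> R,
    [/\ forall v, v \notin int_vertices D -> f v = 0,
        exists v, f v != 0
      & q = dirichlet_energy f / weighted_mass f]]%classic.

End Eigenvalue.

(* The letter (a, true) is the generator a, and (a, false) is its inverse. *)
Definition letter (A : finType) : finType := (A * bool)%type.
Definition word (A : finType) := seq (letter A).

Definition linv (A : finType) (x : letter A) : letter A := (x.1, ~~ x.2).
Definition winv (A : finType) (w : word A) : word A := rev (map (@linv A) w).

Definition cyc_reduced (A : finType) (w : word A) : bool :=
  cycle (fun x y => y != linv x) w.

Record presentation := Presentation {
  gens : finType;
  rels : seq (word gens);
  pr_nonempty : rels != [::];
  pr_rels : forall r, r \in rels -> cyc_reduced r /\ (2 <= size r)%N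
}.

Definition max_relator_length (P : presentation) : nat :=
  (\max_(r <- rels P) size r)%N.

(* Equality of the elements of the presented group represented by two words. *)
Inductive group_eq (P : presentation) : word (gens P) -> word (gens P) -> Prop :=
| group_eq_refl u : group_eq u u
| group_eq_sym u v : group_eq u v -> group_eq v u
| group_eq_trans u v w : group_eq u v -> group_eq v w -> group_eq u w
| group_eq_free u (x : letter (gens P)) v :
    group_eq (u ++ [:: x; linv x] ++ v) (u ++ v)
| group_eq_rel u r v : r \in rels P -> group_eq (u ++ r ++ v) (u ++ v).

Section VanKampen.
Variables (P : presentation) (D : disk_diagram).
Variable lab : dart D -> letter (gens P).

Definition labelling : Prop := forall d, lab (opp_dart d) = linv (lab d).

(* The closed walk starting with d around the region on its left. *)
Definition read_from (d : dart D) : word (gens P) :=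
  map lab (orbit (@fsucc D) d).

Definition faces_read_relators : Prop :=
  forall d : dart D, lface d != None ->
    exists r k, r \in rels P /\
      (read_from d = rot k r \/ read_from d = rot k (winv r)).

(* The boundary walk is read from any of its darts, with the unbounded region
   on the left. *)
Definition boundary_reads (w : word (gens P)) : Prop :=
  (#|edge D| = 0%N /\ w = [::]) \/
  (exists d : dart D, lface d = None /\ w = read_from d).

Definition van_kampen (w : word (gens P)) : Prop :=
  [/\ labelling, faces_read_relators & boundary_reads w].

End VanKampen.

Section Dehn.
Variables (R : realType) (P : presentation).
Local Open Scope ereal_scope.

(* The minimum is +oo if no diagram (without loop edges) has boundary word w. *)
Definition area_min (w : word (gens P)) : \bar R :=
  ereal_inf [set a | exists (D : disk_diagram) (lab : dart D -> letter (gens P)),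
    van_kampen lab w /\ a = ((area D)%:R)%:E]%classic.

Definition dehn (n : nat) : \bar R :=
  ereal_sup [set a | exists w : word (gens P),
    [/\ group_eq w [::], (size w <= n)%N, cyc_reduced w
      & a = area_min w]]%classic.

Definition area_minimising (D : disk_diagram) : Prop :=
  exists (lab : dart D -> letter (gens P)) (w : word (gens P)),
    van_kampen lab w /\ ((area D)%:R)%:E = area_min w.

Definition dehn_bound (K alpha : R) : Prop :=
  forall n : nat, (1 <= n)%N -> dehn n <= (K * n%:R `^ alpha)%:E.

End Dehn.

Definition face_lengths_le (D : disk_diagram) (L : nat) : Prop :=
  forall s : dface D, (face_length s <= L)%N.

(* Main.v *)
Require Import Defs.
From mathcomp Require Import all_boot all_order all_algebra.
From mathcomp Require Import all_classical all_reals all_analysis.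
From mathcomp Require Import fintype finset zify ring lra.
Import Order.TTheory GRing.Theory Num.Theory.
Local Open Scope ring_scope.
Set Implicit Arguments.
Unset Strict Implicit.
Unset Printing Implicit Defensive.

(** All three estimates are lower bounds for [lambda1], that is, Poincare
    inequalities [weighted_mass f <= C * dirichlet_energy f] for functions
    vanishing on the boundary.

    For the bound by filling length times area, a based shelling is a sweep-out
    by closed curves through [b]: every vertex [v] is removed at some stage, and
    at that stage it lies on the current boundary together with [b].  The
    boundary of a simply connected subcomplex is connected, so [v] and [b] are
    joined by a path using each boundary edge at most once, hence of length at
    most the filling length.  Cauchy-Schwarz along this path bounds [f v ^+ 2]
    by the filling length times the energy ([boundary_vertex_bound]); summing
    over the interior vertices with their degrees costs a factor at most
    [L * area].  That the boundary stays connected is an invariant of shelling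
    steps: both sides of a step have Euler characteristic 1, which forces all
    interior vertices of a removed arc (all vertices but one, if the arc is the
    whole boundary of the 2-cell) to disappear with it
    ([arc_removal_bd_linked]).  Shellings exist ([shelling_exists]): remove a
    2-cell together with a single exposed edge as long as there are 2-cells, then
    remove the leaves of the remaining tree.

    For a minimal diagram the area is at most the Dehn function at the length of
    its boundary, hence at the filling length.  The word on the boundary need
    not be cyclically reduced, so reductions have to be undone at no cost in
    area.  This goes through a combinatorial form of van Kampen's lemma:
    [fill n w] says that [w] is reached from the empty word by rotations,
    insertions of inverse pairs, and [n] replacements of a subword by a letter
    along a relator.  Collapsing a diagram yields such a derivation
    ([diagram_fill]); conversely a derivation is realised by gluing on spurs and
    chords ([fill_realized]).  No folding of edges is ever used, and the only
    obstruction, loop edges, would make a generator trivial in the group, which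
    a finite value of the Dehn function excludes ([dehn_no_trivial]).

    When the Dehn function is at most [K * n ^ alpha], the exponent
    [2 * alpha - 2] comes from Cheeger's inequality ([cheeger]).  It needs a
    linear isoperimetric inequality for arbitrary sets [A] of 2-cells with
    constant [K * N ^ (alpha - 1)], [N] being the filling length
    ([linear_isoperimetry]).  An extremal violation [A] is connected and
    has no holes ([extremal_region]); then the diagram can be collapsed onto a
    simply connected subcomplex with 2-cells [A] and without bridges or leaves,
    whose boundary is exactly that of [A] ([region_perimeter]).  Minimality
    bounds [A] by the Dehn function of its own perimeter [p], so by
    [K * p ^ alpha], and also by the total area, at most [K * N ^ alpha].
    The first bound serves when [p <= N] and the second when [p > N]. *)

(** * Paths and orbits of finite maps *)

Section FiniteDynamics.
Local Open Scope nat_scope.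

(** Every retraction argument below has this form: an edge deleted from a
    graph is replaced by a path, or contracted. *)
Lemma connect_map (T1 T2 : finType) (e1 : rel T1) (e2 : rel T2) (r : T1 -> T2) :
  (forall x y, e1 x y -> connect e2 (r x) (r y)) ->
  forall x y, connect e1 x y -> connect e2 (r x) (r y).
Proof.
move=> h x y /connectP[p]; elim: p x => [|z p IH] x /=; first by move=> _ ->.
by case/andP=> /h h1 h2 h3; apply: connect_trans h1 (IH _ h2 h3).
Qed.

Lemma iter_order_inj (T : finType) (f : T -> T) x i j :
  i < order f x -> j < order f x -> iter i f x = iter j f x -> i = j.
Proof.
move=> hi hj h; have := nth_uniq x _ _ (orbit_uniq f x).
move=> /(_ i j); rewrite size_orbit => /(_ hi hj).
by rewrite /orbit !nth_traject // h eqxx => /esym/eqP.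
Qed.

Variables (T T' : finType) (f : T -> T) (f' : T' -> T') (h : T -> T').

Lemma fpath_image n d :
  (forall i, i < n -> f' (h (iter i f d)) = h (iter i.+1 f d)) ->
  fpath f' (h d) (map h (traject f (f d) n)).
Proof.
elim: n d => //= n IH d H; rewrite -(H 0) //= eqxx /= (H 0) //=; apply: IH => i hi.
by rewrite -!iterSr; apply: (H i.+1).
Qed.

Lemma orbit_fcycle d p : uniq (d :: p) -> fcycle f (d :: p) -> orbit f d = d :: p.
Proof.
move=> hu hc; have ho := order_cycle hc hu (mem_head d p).
move: hc => /=; rewrite rcons_path => /andP[/fpathE hp _].
by rewrite /orbit ho /= -hp.
Qed.

(** Used to read faces that a surgery leaves alone: there the new successor
    map is the image of the old one. *)
Lemma orbit_image d : injective h ->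
  (forall n, f' (h (iter n f d)) = h (iter n.+1 f d)) ->
  orbit f' (h d) = map h (orbit f d).
Proof.
move=> hi H; have hit n : iter n f' (h d) = h (iter n f d).
  by elim: n => //= n ->; apply: H.
have ho : order f' (h d) = order f d.
  rewrite -(size_orbit f) -(size_map h) -(card_uniqP _); last by rewrite map_inj_uniq ?orbit_uniq.
  apply: eq_card => y; rewrite -topredE /=; apply/idP/mapP => [/iter_findex <-|[x]].
    by rewrite hit; exists (iter (findex f' (h d) y) f d); rewrite // -fconnect_orbit fconnect_iter.
  rewrite -fconnect_orbit => /iter_findex <- ->.
  by rewrite -hit fconnect_iter.
rewrite /orbit ho; apply: (@eq_from_nth _ (h d)); rewrite ?size_map !size_traject // => i hn.
by rewrite (nth_map d) ?size_traject // !nth_traject.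
Qed.

End FiniteDynamics.

(** * Darts, faces and frontiers *)

Section DiagramBasics.
Variable D : disk_diagram.
Implicit Types (d : dart D) (v : vert D) (s : dface D) (S T : subcx D).

Lemma opp_dartK d : opp_dart (opp_dart d) = d.
Proof. by case: d => e o; rewrite /opp_dart /= negbK. Qed.

Lemma opp_dart_neq d : opp_dart d != d.
Proof. by case: d => e []; apply/eqP => -[]. Qed.

Lemma dart_same_edge d d' : d.1 = d'.1 -> d = d' \/ d = opp_dart d'.
Proof.
by case: d d' => e o [e' o'] /= ->; case: o o' => [] []; [left|right|right|left].
Qed.

Lemma src_fsucc d : src (fsucc d) = src (opp_dart d).
Proof.
apply/esym/dd_vertP; have := fconnect1 (fun x => fsucc (opp_dart x)) (opp_dart d).
by rewrite /= opp_dartK.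
Qed.

Lemma lface_fsucc d : lface (fsucc d) = lface d.
Proof. by apply/esym/dd_faceP/fconnect1. Qed.

Lemma lface_iter n d : lface (iter n (@fsucc D) d) = lface d.
Proof. by elim: n => //= n <-; rewrite lface_fsucc. Qed.

Lemma fsucc_neq d : fsucc d != d.
Proof.
apply/eqP => h; have := dd_noloop d.
by rewrite -src_fsucc h eqxx.
Qed.

(** Connectedness of the surface: [opp_dart] and [fsucc] act transitively on
    darts, because the darts at a vertex form one orbit of their composite and
    the 1-skeleton is connected. *)
Lemma dart_ind (P : pred (dart D)) d0 :
  (forall d, P d -> P (opp_dart d)) -> (forall d, P d -> P (fsucc d)) ->
  P d0 -> forall d, P d.
Proof.
move=> Po Pf P0 d.
have Pv d1 d2 : src d1 = src d2 -> P d1 -> P d2.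
  move=> /dd_vertP /iter_findex <- P1.
  by elim: (findex _ _ _) => //= n IH; apply/Pf/Po.
have /connectP[p] := dd_connected (src d0) (src d).
elim: p d0 P0 => [|y p IH] d0 P0 /=; first by move=> _ /esym h; apply: Pv P0.
case/andP => /existsP[d1 /andP[/eqP h1 /eqP h2]] hp hl.
apply: (IH (opp_dart d1)); last by rewrite h2.
- by apply: Po; apply: Pv P0.
- by rewrite h2.
Qed.

Definition facing (A : {set dface D}) d : bool :=
  if lface d is Some s then s \in A else false.

(** Recording a frontier edge by its dart on the side of [A] counts it once. *)
Definition frontier (A : {set dface D}) : {set dart D} :=
  [set d | facing A d && ~~ facing A (opp_dart d)].

(** A set of 2-cells without frontier is closed under [opp_dart] and [fsucc],
    so it would contain the unbounded region by connectedness. *)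
Lemma frontier_eq0 A : frontier A = set0 -> A = set0.
Proof.
move=> hf; apply/eqP/negPn/negP => /set0Pn[s sA].
have [d0 hd0] := dd_face_surj s.
have hP d : facing A d.
  apply: (@dart_ind (facing A) d0) => [d1 h1|d1|]; last by rewrite /facing hd0.
  - apply/negPn/negP => h2; have : d1 \in frontier A by rewrite inE h1.
    by rewrite hf inE.
  - by rewrite /facing lface_fsucc.
have [|d1 hd1] := @dd_outer D; first by apply/card_gt0P; exists d0.1.
by have := hP d1; rewrite /facing hd1.
Qed.

Definition adj S : rel (vert D) := fun x y =>
  [exists d : dart D, [&& d.1 \in sedges S, src d == x & src (opp_dart d) == y]].

Lemma adj_sym S : symmetric (adj S).
Proof.
have h x y : adj S x y -> adj S y x.
  case/existsP=> d /and3P[h1 h2 h3]; apply/existsP; exists (opp_dart d).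
  by rewrite opp_dartK h1 h3.
by move=> x y; apply/idP/idP; apply: h.
Qed.

Lemma adj_connect_sym S : connect_sym (adj S).
Proof. exact/sym_connect_sym/adj_sym. Qed.

Lemma adj_dart S d : d.1 \in sedges S -> adj S (src d) (src (opp_dart d)).
Proof. by move=> h; apply/existsP; exists d; rewrite h !eqxx. Qed.

Lemma bdart_facing S d : bdart S d = (d.1 \in sedges S) && ~~ facing (sfaces S) d.
Proof. by rewrite /bdart /facing; case: (lface d). Qed.

End DiagramBasics.

(** * Elementary collapses *)

Section Collapse.
Local Open Scope nat_scope.
Variable D : disk_diagram.
Implicit Types (d : dart D) (v b : vert D) (s : dface D) (S T : subcx D).

Definition del_face S (s : dface D) (e : edge D) : subcx D :=
  Subcx (sverts S) (sedges S :\ e) (sfaces S :\ s).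

Definition del_leaf S d : subcx D :=
  Subcx (sverts S :\ src d) (sedges S :\ d.1) (sfaces S).

(** The situation in which the 2-cell [s] can be merged with the outside by
    deleting the edge of [d]. *)
Definition free_side S s d :=
  [/\ lface d = Some s, s \in sfaces S & bdart S (opp_dart d)].

(** Both sides must be outside: a leaf poking into the interior of a 2-cell of
    [S] cannot be removed without removing that 2-cell. *)
Definition free_leaf S d :=
  [/\ bdart S d, bdart S (opp_dart d)
    & forall d', d'.1 \in sedges S -> src d' = src d -> d' = d].

Lemma free_side_uniq S s d d' : free_side S s d -> lface d' = Some s -> d'.1 = d.1 -> d' = d.
Proof.
case=> h1 h2 h3 h4 /dart_same_edge[//|h5].
by move: h3; rewrite bdart_facing -h5 /facing h4 h2 andbF.
Qed.

(** The rest of the boundary walk of [s] avoids the exposed edge, because the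
    other side of that edge is outside. *)
Lemma free_side_arc S s d : subcx_closed S -> free_side S s d ->
  forall n, n < order (@fsucc D) d -> connect (adj (del_face S s d.1)) (src (fsucc d))
     (src (iter n (@fsucc D) (fsucc d))).
Proof.
move=> [_ hc] hs; elim=> [|n IH] hn //=.
apply: connect_trans (IH (ltnW hn)) (connect1 _).
rewrite src_fsucc; apply: adj_dart; rewrite -iterSr.
have hl m : lface (iter m (@fsucc D) d) = Some s by rewrite lface_iter; case: hs.
rewrite in_setD1 (hc _ s) ?hl //; last by case: hs.
rewrite andbT; apply/eqP => he.
have := free_side_uniq hs (hl n.+1) he.
by move/(iter_order_inj (j := 0) hn (order_gt0 _ _)).
Qed.

(** The rest of the boundary of the 2-cell bypasses the deleted edge. *)
Lemma del_face_disk S s d : subcx_closed S -> subcx_connected S -> free_side S s d ->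
  subcx_closed (del_face S s d.1) /\ subcx_connected (del_face S s d.1).
Proof.
move=> hcl hco hs; have [hc1 hc2] := hcl; split; first split.
- by move=> d' /=; rewrite in_setD1 => /andP[_]; apply: hc1.
- move=> d' s' h /=; rewrite !in_setD1 => /andP[h1 h2].
  rewrite (hc2 _ _ h h2) andbT; apply: contra h1 => /eqP he.
  case: (hs) => g1 g2 g3; case: (dart_same_edge he) => hh.
    by move: h; rewrite hh g1 => -[->].
  by move: g3; rewrite -hh bdart_facing /facing h h2 andbF.
- move=> u v hu hv; have := hco u v hu hv; apply: (@connect_map _ _ _ _ id).
  have hd : connect (adj (del_face S s d.1)) (src (opp_dart d)) (src d).
    have h0 : 0 < order (@fsucc D) d by apply: order_gt0.
    have := @free_side_arc _ _ _ hcl hs (order (@fsucc D) d).-1.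
    rewrite prednK // leqnn => /(_ isT).
    rewrite -iterSr prednK // iter_order ?src_fsucc //; exact: dd_fsucc_inj.
  move=> x y /existsP[d' /and3P[h1 /eqP h2 /eqP h3]] /=.
  have [he|hne] := eqVneq d'.1 d.1; last first.
    apply: connect1; apply/existsP; exists d'.
    by rewrite /= in_setD1 hne h1 h2 h3 !eqxx.
  case: (dart_same_edge he) => h; subst d'; rewrite -h2 -h3 //.
    by rewrite -/(adj (del_face S s d.1)) adj_connect_sym.
  by rewrite opp_dartK.
Qed.

(** Paths are retracted by sending the leaf to its neighbour. *)
Lemma del_leaf_disk S d : subcx_closed S -> subcx_connected S -> free_leaf S d ->
  subcx_closed (del_leaf S d) /\ subcx_connected (del_leaf S d).
Proof.
move=> [hc1 hc2] hco [hb1 hb2 hl]; split; first split.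
- move=> d' /=; rewrite !in_setD1 => /andP[h1 h2]; rewrite hc1 // andbT.
  by apply/eqP => h; move: h1; rewrite (hl d') ?eqxx.
- move=> d' s h /= hs; rewrite in_setD1 (hc2 _ _ h hs) andbT; apply/eqP => he.
  case: (dart_same_edge he) => hh; [move: hb1|move: hb2];
  by rewrite bdart_facing -hh /facing h hs andbF.
- move=> u v /=; rewrite !in_setD1 => /andP[u1 u2] /andP[v1 v2].
  pose r x := if x == src d then src (opp_dart d) else x.
  have := hco u v u2 v2.
  have {2}-> : u = r u by rewrite /r (negbTE u1).
  have {2}-> : v = r v by rewrite /r (negbTE v1).
  apply: connect_map => x y /existsP[d' /and3P[h1 /eqP h2 /eqP h3]].
  have hdd : src (opp_dart d) == src d = false by rewrite eq_sym; apply/negbTE/dd_noloop.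
  have [he|hne] := eqVneq d'.1 d.1; last first.
    have /negbTE e1 : x != src d.
      by apply/eqP => h; move: hne; rewrite (hl d') ?h2 ?h ?eqxx.
    have /negbTE e2 : y != src d.
      apply/eqP => h; move: hne.
      by rewrite -(hl (opp_dart d')) ?h3 ?h ?eqxx.
    rewrite /r e1 e2; apply: connect1; apply/existsP; exists d'.
    by rewrite /= in_setD1 hne h1 h2 h3 !eqxx.
  case: (dart_same_edge he) => h; subst d'; rewrite -h2 -h3 /r ?opp_dartK ?eqxx ?hdd //.
Qed.

Lemma card_del_face S s d : subcx_closed S -> free_side S s d ->
  #|sedges S| = #|sedges (del_face S s d.1)|.+1 /\
  #|sfaces S| = #|sfaces (del_face S s d.1)|.+1.
Proof.
move=> [_ hc] [h1 h2 h3]; rewrite (cardsD1 d.1 (sedges S)) (cardsD1 s (sfaces S)) h2.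
by rewrite (hc _ _ h1 h2).
Qed.

Lemma card_del_leaf S d : subcx_closed S -> free_leaf S d ->
  #|sedges S| = #|sedges (del_leaf S d)|.+1 /\
  #|sverts S| = #|sverts (del_leaf S d)|.+1.
Proof.
move=> [hc _] [/andP[h1 _] _ _]; rewrite (cardsD1 d.1 (sedges S)) (cardsD1 (src d) (sverts S)) h1.
by rewrite (hc _ h1).
Qed.

End Collapse.

(** * Euler characteristic and existence of shellings *)

Section Euler.
Local Open Scope nat_scope.
Variable D : disk_diagram.
Implicit Types (d : dart D) (v b : vert D) (s : dface D) (S T : subcx D).

Lemma subcx_dart S u v : subcx_connected S -> u \in sverts S -> v \in sverts S ->
  u != v -> exists2 d, d.1 \in sedges S & src d = u.
Proof.
move=> hco hu hv huv; have /connectP[[|y p] /=] := hco u v hu hv.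
  by move=> _ h; rewrite h eqxx in huv.
by case/andP => /existsP[d /and3P[h1 /eqP h2 _]] _ _; exists d.
Qed.

(** Degree count: a connected graph with fewer edges than vertices, and more
    than one vertex, cannot have degree at least 2 at all vertices but one.
    The excluded vertex [b] serves as basepoint, or as the foot of a bridge. *)
Lemma leaf_exists S b : subcx_closed S -> subcx_connected S ->
  #|sedges S| < #|sverts S| -> b \in sverts S -> 1 < #|sverts S| ->
  exists d, [/\ d.1 \in sedges S, src d != b
    & forall d', d'.1 \in sedges S -> src d' = src d -> d' = d].
Proof.
move=> [hc _] hco hlt hb hV.
pose dg v := #|[set d : dart D | (d.1 \in sedges S) && (src d == v)]|.
have hsum : \sum_(v in sverts S) dg v = (#|sedges S|).*2.
  rewrite -muln2 -card_bool -cardsT -cardsX -sum1_card.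
  rewrite (partition_big (@src D) (mem (sverts S))) /=; last first.
    by case=> e o; rewrite in_setX => /andP[h _]; apply: (hc (e, o)).
  apply: eq_bigr => v _; rewrite /dg -sum1_card; apply: eq_bigl => -[e o].
  by rewrite in_setX !inE andbT.
have hdg v : v \in sverts S -> 0 < dg v.
  move=> hv; have /card_gt1P[x [y [hx hy hxy]]] := hV.
  have [w hw hvw] : exists2 w, w \in sverts S & v != w.
    by have [h|h] := eqVneq v x; [exists y; rewrite ?h | exists x].
  have [d h1 h2] := subcx_dart hco hv hw hvw.
  by apply/card_gt0P; exists d; rewrite inE h1 h2 eqxx.
have [/existsP[v /and3P[v1 v2 /cards1P[d /setP hd]]]|hno] :=
    boolP [exists v, [&& v \in sverts S, v != b & dg v == 1]].
  have := hd d; rewrite !inE eqxx => /andP[d1 /eqP d2].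
  exists d; split; rewrite ?d2 // => d' g1 g2.
  by have := hd d'; rewrite !inE g1 g2 eqxx => /esym/eqP.
have h2 v : v \in sverts S :\ b -> 1 < dg v.
  rewrite in_setD1 => /andP[vb vS].
  have := hdg v vS; rewrite leq_eqVlt => /orP[/eqP h|//].
  by case/negP: hno; apply/existsP; exists v; rewrite vS vb -h eqxx.
(* Degree at least 2 off [b] and at least 1 at [b]. *)
have : (\sum_(v in sverts S :\ b) 2) + 1 <= (#|sedges S|).*2.
  rewrite -hsum [leqRHS](bigD1 b) //= [leqRHS]addnC leq_add ?hdg //.
  rewrite [leqRHS](eq_bigl (mem (sverts S :\ b))); last by move=> v; rewrite !inE andbC.
  exact: leq_sum.
move: hlt; rewrite sum_nat_const (cardsD1 b (sverts S)) hb; lia.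
Qed.

Lemma free_side_exists S d s : subcx_closed S -> d \in frontier (sfaces S) ->
  lface d = Some s -> free_side S s d.
Proof.
move=> [_ hc]; rewrite inE /facing => /andP[h1 h2] hs; rewrite hs in h1.
by split=> //; rewrite bdart_facing h2 andbT; apply: (hc d s).
Qed.

Lemma exposed_face S : subcx_closed S -> sfaces S != set0 ->
  exists s d, free_side S s d.
Proof.
move=> hc hA; case: (set_0Vmem (frontier (sfaces S))) => [/frontier_eq0 h|[d hd]].
  by rewrite h eqxx in hA.
move: (hd); rewrite inE /facing; case E: (lface d) => [s|] // _.
by exists s, d; apply: free_side_exists.
Qed.

Lemma facing0 d : facing set0 d = false.
Proof. by rewrite /facing; case: (lface d) => // s; rewrite inE. Qed.

Lemma leaf_faceless S d : sfaces S = set0 -> d.1 \in sedges S ->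
  (forall d', d'.1 \in sedges S -> src d' = src d -> d' = d) -> free_leaf S d.
Proof. by move=> h1 h2 h3; split=> //; rewrite bdart_facing h1 facing0 /= h2. Qed.

(** Collapsing 2-cells through exposed edges preserves the Euler
    characteristic and ends with a connected graph.  Equality is simple
    connectedness; the inequality for other subcomplexes is what shows that an
    edge outside all 2-cells is a bridge. *)
Lemma euler_le S : subcx_closed S -> subcx_connected S ->
  #|sverts S| + #|sfaces S| <= #|sedges S| + 1.
Proof.
have [n] := ubnP (#|sedges S|); elim: n S => // n IH S hn hcl hco.
have [hF|hF] := eqVneq (sfaces S) set0; last first.
  have [s [d hs]] := exposed_face hcl hF.
  have [h1 h2] := del_face_disk hcl hco hs.
  have [h3 h4] := card_del_face hcl hs.
  have := IH _ _ h1 h2; rewrite h3 h4 -[sverts (del_face _ _ _)]/(sverts S); lia.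
rewrite hF cards0 addn0.
have [hV|hV] := leqP #|sverts S| 1; first by lia.
rewrite leqNgt; apply/negP => hlt.
have [b hb] : exists b, b \in sverts S by apply/card_gt0P; lia.
have hlt' : #|sedges S| < #|sverts S| by lia.
have [d [h1 h2 h3]] := @leaf_exists S b hcl hco hlt' hb hV.
have hl := leaf_faceless hF h1 h3.
have [g1 g2] := del_leaf_disk hcl hco hl.
have [g3 g4] := card_del_leaf hcl hl.
have := IH _ _ g1 g2; rewrite /= hF cards0; move: hlt hn; rewrite g3 g4 /=; lia.
Qed.

Lemma full_disk : subcx_disk (full_subcx D).
Proof.
split.
- by split=> *; rewrite inE.
- move=> u v _ _; have := dd_connected u v; apply: (@connect_map _ _ _ _ id) => x y h.
  apply: connect1; case/existsP: h => d /andP[h1 h2]; apply/existsP; exists d.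
  by rewrite h1 h2 inE.
- by rewrite /= !cardsT dd_euler.
Qed.

(** If the exposed edge carried the only boundary dart at [b], the next dart
    along the removed 2-cell takes over. *)
Lemma bvert_del_face S s d b : subcx_closed S -> free_side S s d ->
  bvert S b -> bvert (del_face S s d.1) b.
Proof.
move=> hcl hs /andP[hb hor]; have [_ hc] := hcl; rewrite /bvert /= hb /=.
have [g1 g2 g3] := hs.
have key d' : bdart S d' -> d' != opp_dart d -> bdart (del_face S s d.1) d'.
  move=> h1 h2; rewrite bdart_facing /=.
  move: h1; rewrite bdart_facing in_setD1 => /andP[-> h3]; rewrite andbT.
  apply/andP; split.
    apply/eqP => he; case: (dart_same_edge he) => h; last by rewrite h eqxx in h2.
    by move: h3; rewrite /facing h g1 g2.
  by apply: contra h3; rewrite /facing; case: (lface d') => // s'; rewrite in_setD1 => /andP[].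
case/orP: hor => [/existsP[d' /andP[h1 h2]]|/forallP hno]; last first.
  apply/orP; right; apply/forallP => d'; apply/implyP; rewrite in_setD1 => /andP[_].
  exact/implyP.
apply/orP; left; apply/existsP.
have [he|hne] := eqVneq d' (opp_dart d); last by exists d'; rewrite key.
exists (fsucc d); rewrite src_fsucc -he h2 andbT bdart_facing /facing lface_fsucc g1 !in_setD1.
rewrite eqxx /= (hc _ s) ?lface_fsucc // !andbT.
apply/eqP => h; case: (dart_same_edge h) => hh.
  by have := fsucc_neq d; rewrite hh eqxx.
by move: g3; rewrite -hh bdart_facing /facing lface_fsucc g1 g2 andbF.
Qed.

(** An arc of length 1 has no interior vertex, so no vertex disappears. *)
Lemma face_step_del_face S s d b : subcx_closed S -> subcx_connected S ->
  free_side S s d -> b \in sverts S ->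
  face_step b S (del_face S s d.1).
Proof.
move=> hcl hco hs hb; have [h1 h2] := del_face_disk hcl hco hs.
have [g1 g2 g3] := hs; exists s, d, 1; split => //=.
  by move=> d'; rewrite inE => /eqP ->.
split; apply/setP => x; rewrite !inE; first by rewrite andbC.
apply/idP/andP => [hx|[]//]; split=> //.
have [//|hxb] := eqVneq x b.
have [d' k1 k2] := @subcx_dart _ x b h2 hx hb hxb.
by apply/existsP; exists d'; rewrite k1 k2 eqxx.
Qed.

Definition shelling_from b S : Prop := exists (N : nat) (Sg : nat -> subcx D),
  [/\ Sg 0 = S, Sg N = point_subcx b,
      forall j, j <= N -> subcx_disk (Sg j) /\ bvert (Sg j) b
    & forall j, j < N -> spur_step (Sg j) (Sg j.+1) \/ face_step b (Sg j) (Sg j.+1)].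

Lemma shelling_cons b S T : subcx_disk S -> bvert S b ->
  spur_step S T \/ face_step b S T -> shelling_from b T -> shelling_from b S.
Proof.
move=> h1 h2 h3 [N [Sg [g1 g2 g3 g4]]].
exists N.+1, (fun j => if j is i.+1 then Sg i else S); split => //.
- by case=> // j hj; apply: g3.
- by case=> [_|j hj]; [rewrite g1 | apply: g4].
Qed.

(** While there are 2-cells some edge of one is exposed; what remains
    afterwards is a tree, which has a leaf other than [b]. *)
Lemma shelling_exists b S : subcx_disk S -> bvert S b -> shelling_from b S.
Proof.
have [n] := ubnP (#|sedges S|); elim: n S => // n IH S hn hd hb.
have [hcl hco hE] := hd; have hbS : b \in sverts S by case/andP: hb.
have [hF|hF] := eqVneq (sfaces S) set0; last first.
  have [s [d hs]] := exposed_face hcl hF.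
  have [h1 h2] := del_face_disk hcl hco hs.
  have [h3 h4] := card_del_face hcl hs.
  apply: (@shelling_cons _ _ (del_face S s d.1)) => //.
    by right; apply: face_step_del_face.
  apply: IH; [by lia| |exact: bvert_del_face].
  by split=> //; move: hE; rewrite h3 h4 /=; lia.
have [hV|hV] := leqP #|sverts S| 1.
  have hVb : sverts S = [set b].
    by apply/esym/eqP; rewrite eqEcard sub1set hbS cards1.
  exists 0, (fun=> S); split => //.
  have hE0 : sedges S = set0.
    by apply/eqP; rewrite -cards_eq0; move: hE; rewrite hF cards0; lia.
  by move: hVb hE0 hF; case: (S) => ? ? ? /= -> -> ->.
have hlt : #|sedges S| < #|sverts S| by move: hE; rewrite hF cards0; lia.
have [d [h1 h2 h3]] := @leaf_exists S b hcl hco hlt hbS hV.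
have hl := leaf_faceless hF h1 h3.
have [g1 g2] := del_leaf_disk hcl hco hl.
have [g3 g4] := card_del_leaf hcl hl.
apply: (@shelling_cons _ _ (del_leaf S d)) => //; first by left; exists d.
have hbT : b \in sverts (del_leaf S d) by rewrite in_setD1 eq_sym h2.
apply: IH; first by lia.
  by split=> //; move: hE; rewrite g3 g4 /=; lia.
rewrite /bvert hbT /=.
have [/existsP[d' /andP[k1 k2]]|hno] :=
   boolP [exists d' : dart D, (d'.1 \in sedges (del_leaf S d)) && (src d' == b)].
  apply/orP; left; apply/existsP; exists d'; rewrite k2 andbT bdart_facing.
  by rewrite /= hF facing0 andbT.
apply/orP; right; apply/forallP => d'; apply/implyP => k1; apply/eqP => k2.
by case/negP: hno; apply/existsP; exists d'; rewrite k1 k2 eqxx.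
Qed.

(** Shellings exist, and a nonempty set of naturals contains its infimum. *)
Lemma filling_length_attained b : bd_vertex b -> exists N Sg,
  based_shelling b N Sg /\
  filling_length b = \max_(j < N.+1) perimeter (Sg j).
Proof.
move=> hb; have [N [Sg [h1 h2 h3 h4]]] := shelling_exists full_disk hb.
rewrite /filling_length; set A := (X in infimum _ X).
have hA : exists m, `[< A m >].
  by eexists; apply/asboolP; exists N, Sg; split; [split | reflexivity].
pose m := ex_minn hA.
have hm : A m by rewrite /m; case: ex_minnP => k /asboolP.
have hmin k : A k -> m <= k.
  by move=> hk; rewrite /m; case: ex_minnP => k' _; apply; apply/asboolP.
suff -> : infimum 0 A = m by [].
rewrite /infimum; case: eqP => [h0|_]; first by rewrite h0 in hm.
have hinf x : infimums A x -> x = m.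
  case=> hlb hub; apply/eqP; rewrite eq_le; apply/andP; split; first by apply: hlb.
  by apply: hub => k /hmin.
apply: hinf; apply: (xgetPex 0); exists m; split.
  by move=> k /hmin.
by move=> k; apply.
Qed.

End Euler.

(** * Connectedness of the boundary along a shelling *)

Section Boundary.
Local Open Scope nat_scope.
Variable D : disk_diagram.
Implicit Types (d : dart D) (v b : vert D) (s : dface D) (S T : subcx D).

Definition bd_edges S : {set edge D} :=
  [set e in sedges S | bdart S (e, true) || bdart S (e, false)].

Definition bd_graph S : subcx D := Subcx (sverts S) (bd_edges S) set0.

Definition on_bd S v : Prop := exists2 d, d.1 \in bd_edges S & src d = v.

(** The invariant of shellings that replaces the boundary walk: for the
    distance to the basepoint only the connectedness of the boundary matters,
    not the order in which it is traversed. *)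
Definition bd_linked S : Prop :=
  forall u v, on_bd S u -> on_bd S v -> connect (adj (bd_graph S)) u v.

Lemma bd_edgesE S d : (d.1 \in bd_edges S) = bdart S d || bdart S (opp_dart d).
Proof.
rewrite inE; case: d => e []; rewrite /opp_dart /=.
  by rewrite !bdart_facing /=; case: (e \in _).
by rewrite orbC !bdart_facing /=; case: (e \in _).
Qed.

Lemma card_bd_edges S : #|bd_edges S| <= perimeter S.
Proof.
apply: leq_trans (leq_imset_card (fun d : dart D => d.1) _).
apply/subset_leq_card/subsetP => e; rewrite inE => /andP[_ /orP[h|h]]; apply/imsetP.
  by exists (e, true); rewrite ?inE.
by exists (e, false); rewrite ?inE.
Qed.

Lemma adj_bd S d : d.1 \in bd_edges S -> adj (bd_graph S) (src d) (src (opp_dart d)).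
Proof. exact: (@adj_dart _ (bd_graph S)). Qed.

(** The darts with the unbounded region on their left form a single orbit of
    [fsucc]. *)
Lemma bd_linked_full : bd_linked (full_subcx D).
Proof.
have hb d : bdart (full_subcx D) d -> lface d = None.
  by rewrite bdart_facing inE /facing; case: (lface d) => //= s; rewrite inE.
have hN d : lface d = None -> d.1 \in bd_edges (full_subcx D).
  by move=> h; rewrite bd_edgesE !bdart_facing !inE /facing h.
have h1 d d' : lface d = None -> lface d' = None ->
    connect (adj (bd_graph (full_subcx D))) (src d) (src d').
  move=> e e'; have : lface d = lface d' by rewrite e e'.
  move=> /dd_faceP /iter_findex <-; elim: (findex _ _ _) => //= n IH.
  apply: connect_trans IH (connect1 _); rewrite src_fsucc; apply/adj_bd/hN.
  by rewrite lface_iter.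
have h2 v : on_bd (full_subcx D) v -> exists2 d, lface d = None &
    connect (adj (bd_graph (full_subcx D))) v (src d).
  case=> d hd <-; move: (hd); rewrite bd_edgesE => /orP[/hb h|/hb h]; first by exists d.
  by exists (opp_dart d) => //; apply/connect1/adj_bd.
move=> u v /h2[d hd1 hd2] /h2[d' hd1' hd2'].
apply: connect_trans hd2 _; rewrite adj_connect_sym; apply: connect_trans hd2' _.
exact: h1.
Qed.

Lemma bd_edges_sub S T : sedges T \subset sedges S -> sfaces T \subset sfaces S ->
  forall e, e \in sedges T -> e \in bd_edges S -> e \in bd_edges T.
Proof.
move=> hE hF e he; rewrite -[e]/((e, true).1) !bd_edgesE.
have hf d : facing (sfaces T) d -> facing (sfaces S) d.
  by rewrite /facing; case: (lface d) => // s; apply: (subsetP hF).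
rewrite !bdart_facing /= he (subsetP hE _ he) /= => /orP[h|h]; apply/orP.
  by left; apply: contra h; apply: hf.
by right; apply: contra h; apply: hf.
Qed.

Lemma spur_step_bd_linked S T : subcx_disk T -> spur_step S T -> bd_linked S -> bd_linked T.
Proof.
move=> [[hcl _] _ _] [d [hd hl hV hE hF]] hS.
have hon v : on_bd T v -> on_bd S v /\ v != src d.
  case=> d' h1 <-; split.
    exists d' => //; move: h1; rewrite !bd_edgesE !bdart_facing hE hF /= !in_setD1.
    by case: (d'.1 == d.1).
  have : src d' \in sverts T by apply: hcl; move: h1; rewrite inE => /andP[].
  by rewrite hV in_setD1 => /andP[].
move=> u v /hon[u1 u2] /hon[v1 v2].
pose r x := if x == src d then src (opp_dart d) else x.
have := hS u v u1 v1.
have {2}-> : u = r u by rewrite /r (negbTE u2).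
have {2}-> : v = r v by rewrite /r (negbTE v2).
apply: connect_map => x y /existsP[d' /and3P[h1 /eqP h2 /eqP h3]].
have h1S : d'.1 \in sedges S by move: h1; rewrite inE => /andP[].
have hdd : src (opp_dart d) == src d = false by rewrite eq_sym; apply/negbTE/dd_noloop.
have [he|hne] := eqVneq d'.1 d.1; last first.
  have /negbTE e1 : x != src d.
    by apply/eqP => h; move: hne; rewrite (hl d') ?h2 ?h ?eqxx.
  have /negbTE e2 : y != src d.
    by apply/eqP => h; move: hne; rewrite -(hl (opp_dart d')) ?h3 ?h ?eqxx.
  rewrite /r e1 e2; apply: connect1; rewrite -h2 -h3; apply: adj_bd.
  apply: (@bd_edges_sub S T) => //; first by rewrite hE subsetDl.
    by rewrite hF.
  by rewrite hE in_setD1 hne.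
by case: (dart_same_edge he) => h; subst d'; rewrite -h2 -h3 /r ?opp_dartK ?eqxx ?hdd.
Qed.

(** A 2-cell on the left of the spur would be in [T] while the edge of the
    spur is not, so the left side is outside. *)
Lemma spur_removed_on_bd S T v : subcx_disk S -> subcx_disk T -> spur_step S T ->
  v \in sverts S -> v \notin sverts T -> on_bd S v.
Proof.
move=> [[_ hclS] _ _] [[_ hcl] _ _] [d [hd hl hV hE hF]] vS; rewrite hV in_setD1 vS andbT negbK.
move=> /eqP ->; exists d => //; rewrite bd_edgesE; apply/orP; left.
rewrite bdart_facing hd /= /facing; case E: (lface d) => [s|] //.
apply/negP => hs; have := hcl d s E; rewrite hF => /(_ hs).
by rewrite hE in_setD1 eqxx.
Qed.

Section FaceStep.
Variables (b : vert D) (S T : subcx D) (s : dface D) (d : dart D) (k : nat).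
Hypotheses (hS : subcx_disk S) (hT : subcx_disk T) (hbS : b \in sverts S).
Let arc := traject (@fsucc D) d k.
Hypotheses (hs : s \in sfaces S) (hk : 0 < k)
  (harc : {in arc, forall d', lface d' = Some s /\ bdart S (opp_dart d')})
  (hF : sfaces T = sfaces S :\ s)
  (hE : sedges T = [set e in sedges S | e \notin [seq d'.1 | d' <- arc]])
  (hV : sverts T = [set v in sverts S |
          (v == b) || [exists d' : dart D, (d'.1 \in sedges T) && (src d' == v)]]).

Let m := order (@fsucc D) d.
(* The arc may be longer than the boundary of [s], in which case it wraps
   around; only its first [K] darts are distinct. *)
Let K := minn k m.
Let di i := iter i (@fsucc D) d.
Let x i := src (di i).

Let lface_di i : lface (di i) = Some s.
Proof.
have [h _] : lface d = Some s /\ bdart S (opp_dart d).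
  by apply: harc; rewrite /arc; case: (k) hk => //= k' _; rewrite inE eqxx.
by rewrite /di lface_iter.
Qed.

Let m_gt0 : 0 < m. Proof. exact: order_gt0. Qed.

Let di_m i : di (i + m) = di i.
Proof. by rewrite /di iterD iter_order //; exact: dd_fsucc_inj. Qed.

Let di_mod i : di i = di (i %% m).
Proof. by rewrite {1}(divn_eq i m) addnC; elim: (i %/ m) => [|q IH]; rewrite ?addn0 // mulSn addnCA addnC di_m. Qed.

Let di_inj i j : i < m -> j < m -> di i = di j -> i = j.
Proof. exact: iter_order_inj. Qed.

Let in_arc d' : reflect (exists2 i, i < K & d' = di i) (d' \in arc).
Proof.
apply: (iffP trajectP) => [[i hi ->]|[i hi ->]]; last first.
  by exists i => //; apply: leq_trans hi (geq_minl _ _).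
rewrite -/(di i) di_mod; exists (i %% m) => //.
by rewrite leq_min ltn_mod m_gt0 andbT (leq_ltn_trans (leq_mod _ _) hi).
Qed.

Let bd_opp i : i < K -> bdart S (opp_dart (di i)).
Proof. by move=> hi; case: (@harc (di i)) => //; apply/in_arc; exists i. Qed.

Let di_S i : (di i).1 \in sedges S.
Proof. by case: hS => -[_ h] _ _; apply: h (lface_di i) hs. Qed.

Let same_edge d' i : lface d' = Some s -> i < K -> d'.1 = (di i).1 -> d' = di i.
Proof.
move=> h1 h2 /dart_same_edge[//|h3].
by have := bd_opp h2; rewrite -h3 bdart_facing /facing h1 hs andbF.
Qed.

Let arc_edge d' : d'.1 \in [seq d'.1 | d' <- arc] ->
  exists2 i, i < K & d' = di i \/ d' = opp_dart (di i).
Proof. by case/mapP => d2 /in_arc[i hi ->] /dart_same_edge h; exists i. Qed.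

Let card_arc : #|sedges S| = #|sedges T| + K.
Proof.
rewrite -(cardsID (sedges T) (sedges S)); congr (_ + _).
  by apply: eq_card => e; rewrite hE !inE andbA andbb.
have -> : sedges S :\: sedges T = [set (di i).1 | i : 'I_K].
  apply/setP => e; rewrite hE !inE; apply/andP/imsetP => [[h1 h2]|[i _ ->]].
    move: h1; rewrite h2 /= negbK -[e]/((e, true).1) => /arc_edge[i hi hd].
    exists (Ordinal hi) => //=; by case: hd => h; have := congr1 fst h.
  rewrite di_S /= negbK; split=> //; apply/mapP; exists (di i) => //.
  by apply/in_arc; exists i.
rewrite card_imset ?card_ord // => i j h; apply/val_inj.
have h1 : di i = di j by apply: same_edge.
by apply: di_inj => //; rewrite (leq_trans (ltn_ord _)) // geq_minr.
Qed.

Let Rm := sverts S :\: sverts T.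

(* One 2-cell and [K] edges are lost while the Euler characteristic stays 1. *)
Let cardRm : #|Rm| = K.-1.
Proof.
have hVT : sverts T \subset sverts S by rewrite hV; apply/subsetP => v; rewrite inE => /andP[].
have := cardsID (sverts T) (sverts S); rewrite -/Rm (setIidPr hVT).
case: hS => _ _; case: hT => _ _; rewrite card_arc hF (cardsD1 s (sfaces S)) hs.
have : 0 < K by rewrite leq_min hk m_gt0.
lia.
Qed.

Let Rm_notin v d' : v \in Rm -> d'.1 \in sedges S -> src d' = v ->
  d'.1 \in [seq d'.1 | d' <- arc].
Proof.
rewrite in_setD hV inE => /andP[h1 h2] h3 h4; move: h1; rewrite h2 /= negb_or => /andP[_].
move=> /existsPn /(_ d'); rewrite h4 eqxx andbT hE inE h3 /= negbK; exact.
Qed.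

Let Rm_b v : v \in Rm -> v != b.
Proof. by rewrite in_setD hV inE => /andP[h1 h2]; move: h1; rewrite h2 /= negb_or => /andP[]. Qed.

Let Rm_x v : v \in Rm -> exists2 i, i < K & v = x i \/ v = x i.+1.
Proof.
move=> hv; have hvS : v \in sverts S by move: hv; rewrite in_setD => /andP[].
case: hS => _ hco _; have [d' h1 h2] := subcx_dart hco hvS hbS (Rm_b hv).
have [i hi [h|h]] := arc_edge (Rm_notin hv h1 h2); exists i => //.
  by left; rewrite -h2 h.
by right; rewrite -h2 h /x /di /= src_fsucc.
Qed.

Lemma arc_removed_on_bd v : v \in sverts S -> v \notin sverts T -> on_bd S v.
Proof.
move=> h1 h2; have hv : v \in Rm by rewrite in_setD h2.
case: hS => _ hco _; have [d' h3 h4] := subcx_dart hco h1 hbS (Rm_b hv).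
have [i hi hd] := arc_edge (Rm_notin hv h3 h4); exists d' => //.
by rewrite bd_edgesE; case: hd => ->; rewrite ?opp_dartK bd_opp ?orbT.
Qed.

Let TsubE : sedges T \subset sedges S.
Proof. by rewrite hE; apply/subsetP => e; rewrite inE => /andP[]. Qed.
Let TsubF : sfaces T \subset sfaces S. Proof. by rewrite hF subsetDl. Qed.

Let di_T i : K <= i < m -> (di i).1 \in bd_edges T.
Proof.
move=> /andP[h1 h2]; rewrite bd_edgesE bdart_facing; apply/orP; left.
rewrite /facing lface_di hF in_setD1 eqxx /= andbT hE inE di_S /=.
apply/negP => /mapP[d2 /in_arc[j hj ->]] h3.
have := di_inj h2 (leq_trans hj (geq_minr _ _)) (same_edge (lface_di i) hj h3).
by move=> h; rewrite h leqNgt hj in h1.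
Qed.

Let linkT i : K <= i -> forall n, i + n <= m -> connect (adj (bd_graph T)) (x i) (x (i + n)).
Proof.
move=> hi; elim=> [|n IH] hn; first by rewrite addn0.
apply: connect_trans (IH _) (connect1 _); first by lia.
rewrite addnS {2}/x /di iterS src_fsucc; apply: adj_bd; apply: di_T; lia.
Qed.

Let x_m : x m = x 0.
Proof. by rewrite /x -[m]add0n di_m. Qed.

Let linkT0 i : K <= i <= m -> connect (adj (bd_graph T)) (x i) (x 0).
Proof. by case/andP => h1 h2; rewrite -x_m -(subnKC h2); apply: linkT => //; lia. Qed.

(* The removed vertices are sent to a surviving vertex [y] so that every edge
   of the arc becomes a path in the new boundary. *)
Let retract : exists2 y, y \notin Rm &
  forall i, i < K -> connect (adj (bd_graph T)) (if x i \in Rm then y else x i)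
                                        (if x i.+1 \in Rm then y else x i.+1).
Proof.
(* If part of the boundary of [s] survives, both ends of the arc do, so by the
   count the removed vertices are exactly the interior vertices of the arc. *)
have [hKm|hKm] := ltnP K m.
  have x0 : x 0 \notin Rm.
    apply/negP => h; have := @Rm_notin _ (opp_dart (di m.-1)) h.
    rewrite -src_fsucc -[fsucc _]/(di m.-1.+1) prednK // -x_m => /(_ (di_S _) erefl).
    case/mapP => d2 /in_arc[j hj ->] /= h3.
    have := same_edge (lface_di m.-1) hj h3; move/di_inj; lia.
  have xK : x K \notin Rm.
    apply/negP => h; have := Rm_notin h (di_S K) erefl.
    case/mapP => d2 /in_arc[j hj ->] /= h3.
    have := same_edge (lface_di K) hj h3; move/di_inj; lia.
  have hall : Rm = [set x (i : 'I_K.-1).+1 | i : 'I_K.-1].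
    apply/eqP; rewrite eqEcard cardRm; apply/andP; split; last first.
      by apply: leq_trans (leq_imset_card _ _) _; rewrite card_ord.
    apply/subsetP => v hv; have [i hi hx] := Rm_x hv.
    have [j h1 h2] : exists2 j, 0 < j < K & v = x j.
      case: hx => h.
        exists i => //; rewrite hi andbT lt0n; apply/eqP => h0.
        by move: x0; rewrite -h0 -h hv.
      exists i.+1 => //=; rewrite ltn_neqAle hi andbT; apply/eqP => h0.
      by move: xK; rewrite -h0 -h hv.
    have hj : j.-1 < K.-1 by lia.
    apply/imsetP; exists (Ordinal hj) => //=; rewrite prednK //; lia.
  have inR j : 0 < j < K -> x j \in Rm.
    move=> h; have hj : j.-1 < K.-1 by lia.
    rewrite hall; apply/imsetP; exists (Ordinal hj) => //=; rewrite prednK //; lia.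
  exists (x 0) => // i hi.
  have -> : (if x i \in Rm then x 0 else x i) = x 0.
    by case: i hi => [|i] hi; [rewrite (negbTE x0) | rewrite inR].
  have [hi2|hi2] := ltnP i.+1 K; first by rewrite inR.
  have -> : i.+1 = K by lia.
  by rewrite (negbTE xK) adj_connect_sym; apply: linkT0; rewrite leqnn ltnW.
(* Otherwise the whole boundary of [s] is removed and at most one of its
   vertices survives.  If none did, the vertices of [s] would form a component
   of [S] without [b]. *)
have hK : K = m by apply/eqP; rewrite eqn_leq geq_minr.
pose X := [set x (i : 'I_m) | i : 'I_m].
have xX i : x i \in X.
  rewrite /x di_mod; apply/imsetP.
  by exists (Ordinal (ltn_pmod i m_gt0)).
have RX : Rm \subset X.
  by apply/subsetP => v /Rm_x[i _ [] ->].
have hX1 : #|X :\: Rm| <= 1.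
  have := cardsID Rm X; rewrite (setIidPr RX) cardRm hK.
  have : #|X| <= m by apply: leq_trans (leq_imset_card _ _) _; rewrite card_ord.
  move: m_gt0; lia.
have [hsub|] := boolP (X \subset Rm).
  exfalso; have hx0 : x 0 \in sverts S by case: hS => -[h _] _ _; apply: h (di_S 0).
  case: hS => _ hco _; have := hco _ _ hx0 hbS => /connectP[p hp hl].
  have : last (x 0) p \in X.
    elim: p (x 0) (xX 0) hp {hl hx0} => //= y p IH u hu /andP[/existsP[d' /and3P[h1 /eqP h2 /eqP h3]] hp].
    apply: IH hp; rewrite -h3.
    have [i hi [->|->]] := arc_edge (Rm_notin (subsetP hsub _ hu) h1 h2).
      by rewrite -src_fsucc; apply: (xX i.+1).
    by rewrite opp_dartK; apply: xX.
  by rewrite -hl => /(subsetP hsub)/Rm_b; rewrite eqxx.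
case/subsetPn => y yX yR; exists y => // i hi.
have hy j : (if x j \in Rm then y else x j) = y.
  case: ifP => // /negbT hj; apply/eqP/negPn/negP => hne.
  move: hX1; rewrite leqNgt => /negP[]; apply/card_gt1P; exists (x j), y.
  by split=> //; apply/setDP.
by rewrite !hy.
Qed.

(** A path in the old boundary is pushed to the new one by the retraction; the
    vertices of the new boundary that were not on the old one lie on the
    complementary arc. *)
Lemma arc_removal_bd_linked : bd_linked S -> bd_linked T.
Proof.
move=> hl; have [y hy hr] := retract.
pose r v := if v \in Rm then y else v.
have hstep u v : adj (bd_graph S) u v -> connect (adj (bd_graph T)) (r u) (r v).
  case/existsP => d' /and3P[h1 /eqP <- /eqP <-].
  have h1S : d'.1 \in sedges S by move: h1; rewrite inE => /andP[].
  have [ha|hna] := boolP (d'.1 \in [seq d'.1 | d' <- arc]).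
    have [i hi [->|->]] := arc_edge ha; have := hr i hi.
      by rewrite /r -src_fsucc.
    by rewrite adj_connect_sym /r opp_dartK -src_fsucc.
  have n1 d2 : d2.1 = d'.1 -> src d2 \notin Rm.
    by move=> h; apply/negP => /Rm_notin /(_ _ erefl); rewrite h (negbTE hna) => /(_ h1S).
  rewrite /r (negbTE (n1 d' erefl)) (negbTE (n1 (opp_dart d') erefl)).
  apply/connect1/adj_bd; apply: (bd_edges_sub TsubE TsubF) => //.
  by rewrite hE inE h1S.
have hon u : on_bd T u -> exists u', [/\ connect (adj (bd_graph T)) u u',
    on_bd S u' & u' \notin Rm].
  case=> d' h1 <-.
  have h1T : d'.1 \in sedges T by move: h1; rewrite inE => /andP[].
  have h1S := subsetP TsubE _ h1T.
  have nR : src d' \notin Rm.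
    by rewrite in_setD negb_and negbK; case: hT => -[-> //].
  have [hb|hb] := boolP (d'.1 \in bd_edges S); first by exists (src d'); split=> //; exists d'.
  have x0on : on_bd S (x 0).
    by exists (di 0) => //; rewrite bd_edgesE bd_opp ?orbT // leq_min hk m_gt0.
  have hfs d2 : d2.1 = d'.1 -> lface d2 = Some s -> exists2 i, K <= i < m & d2 = di i.
    move=> e2; rewrite -(lface_di 0) => /esym/dd_faceP h; exists (findex (@fsucc D) d d2).
      rewrite findex_max // andbT leqNgt; apply/negP => hi.
      have : d2.1 \in sedges T by rewrite e2.
      rewrite hE inE => /andP[_ /negP[]]; apply/mapP; exists d2 => //.
      by apply/in_arc; exists (findex (@fsucc D) d d2); rewrite // /di iter_findex.
    by rewrite /di iter_findex.
  have hw : exists d2, [/\ d2.1 = d'.1, lface d2 = Some s & (d2 = d' \/ d2 = opp_dart d')].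
    move: h1 hb; rewrite !bd_edgesE !bdart_facing h1T h1S /= !negb_or !negbK => h /andP[f1 f2].
    case/orP: h => h.
      exists d'; split; auto; move: f1 h; rewrite /facing; case: (lface d') => // s' g1.
      by rewrite hF in_setD1 g1 andbT negbK => /eqP ->.
    exists (opp_dart d'); split; auto.
    move: f2 h; rewrite /facing; case: (lface (opp_dart d')) => // s' g1.
    by rewrite hF in_setD1 g1 andbT negbK => /eqP ->.
  have hx0 : exists2 i, K <= i <= m & src d' = x i.
    have [d2 [e1 /(hfs _ e1)[i /andP[i1 i2] e2] e3]] := hw.
    case: e3 => e3; first by exists i; rewrite ?i1 ?(ltnW i2) // /x -e2 e3.
    exists i.+1; first by rewrite i2 (leq_trans i1).
    by rewrite /x /di iterS src_fsucc -/(di i) -e2 e3 opp_dartK.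
  have [i hi hxi] := hx0; exists (x 0); split=> //.
    by rewrite hxi; apply: linkT0.
  have hKm : K < m.
    by have [d2 [e1 /(hfs _ e1)[j hj _] _]] := hw; move: hj; lia.
  apply/negP => h; have := @Rm_notin _ (opp_dart (di m.-1)) h.
  rewrite -src_fsucc -[fsucc _]/(di m.-1.+1) prednK // -x_m => /(_ (di_S _) erefl).
  case/mapP => d2 /in_arc[j hj ->] /= h3.
  have := same_edge (lface_di m.-1) hj h3; move/di_inj; lia.
move=> u v /hon[u' [u1 u2 u3]] /hon[v' [v1 v2 v3]].
apply: connect_trans u1 _; rewrite adj_connect_sym; apply: connect_trans v1 _.
have := connect_map hstep (hl v' u' v2 u2).
by rewrite /r (negbTE u3) (negbTE v3).
Qed.

End FaceStep.
End Boundary.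

Section Sweep.
Local Open Scope nat_scope.
Variable D : disk_diagram.
Implicit Types (d : dart D) (v b : vert D) (s : dface D) (S T : subcx D).

Lemma face_step_bd_linked b S T : subcx_disk S -> subcx_disk T -> b \in sverts S ->
  face_step b S T -> bd_linked S -> bd_linked T.
Proof. by move=> h1 h2 h3 [s [d [k [g1 g2 g3 g4 [g5 g6]]]]]; apply: arc_removal_bd_linked g1 g2 g3 g4 g5 g6. Qed.

Lemma bvert_on_bd b S v : subcx_disk S -> bvert S b -> v \in sverts S -> v != b -> on_bd S b.
Proof.
move=> [_ hco _] /andP[hb /orP[/existsP[d /andP[h1 /eqP h2]]|/forallP hno]] hv hvb.
  by exists d => //; rewrite bd_edgesE h1.
rewrite eq_sym in hvb; have [d h1 h2] := subcx_dart hco hb hv hvb.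
by have := hno d; rewrite h1 h2 eqxx.
Qed.

(** Consider the stage at which [v] is removed.  Only boundary vertices are
    ever removed, so [v] is then on the same connected boundary as [b]. *)
Lemma shelling_sweeps b N Sg v : based_shelling b N Sg -> v != b ->
  exists2 j, j <= N & connect (adj (bd_graph (Sg j))) v b.
Proof.
move=> [h0 hN hd hst] hvb.
have hl j : j <= N -> bd_linked (Sg j).
  elim: j => [|j IH] hj; first by rewrite h0; apply: bd_linked_full.
  have [d1 /andP[b1 _]] := hd j (ltnW hj); have [d2 _] := hd j.+1 hj.
  case: (hst j hj) => hs; first exact: (spur_step_bd_linked d2 hs (IH (ltnW hj))).
  exact: (face_step_bd_linked d1 d2 b1 hs (IH (ltnW hj))).
have hex : exists j, v \notin sverts (Sg j) by exists N; rewrite hN inE.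
case: (ex_minnP hex) => -[|j]; first by rewrite h0 inE.
move=> hj hmin; have hjN : j < N by apply: hmin; rewrite hN inE.
have vS : v \in sverts (Sg j).
  by apply/negPn/negP => /hmin; rewrite ltnn.
have [d1 bv1] := hd j (ltnW hjN); have [d2 bv2] := hd j.+1 hjN.
exists j; first exact: ltnW.
apply: hl; [exact: ltnW| |exact: bvert_on_bd vS hvb].
case: (hst j hjN) => hs; first exact: spur_removed_on_bd hs vS hj.
case: hs => [s [d [k [g1 g2 g3 g4 [g5 g6]]]]].
by apply: (arc_removed_on_bd d1 _ g3 g5 g6 vS hj); case/andP: bv1.
Qed.

End Sweep.

(** * Differences along paths and the Cauchy-Schwarz inequality *)

Section Poincare.
Variables (R : realType) (D : disk_diagram).
Implicit Types (d : dart D) (v b : vert D) (s : dface D) (S T : subcx D).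

Definition edge_diff (f : vert D -> R) (e : edge D) : R :=
  f (src (e, true)) - f (src (e, false)).

Lemma edge_diff_dart f d : `|edge_diff f d.1| = `|f (src d) - f (src (opp_dart d))|.
Proof. by case: d => e [] //=; rewrite /edge_diff distrC. Qed.

(** A simple path uses every edge at most once. *)
Lemma path_diff f (S : subcx D) u v : connect (adj S) u v ->
  `|f u - f v| <= \sum_(e in sedges S) `|edge_diff f e|.
Proof.
case/connectP=> p /shortenP[q hq hu _] ->.
(* The edges with both ends on [r]: removing the first vertex of a simple path
   from [r] removes at least its first edge. *)
pose on (r : seq (vert D)) (e : edge D) :=
  [&& e \in sedges S, src (e, true) \in r & src (e, false) \in r].
apply: (@le_trans _ _ (\sum_(e | on (u :: q) e) `|edge_diff f e|)); last first.
  rewrite [leRHS](bigID (on (u :: q))) /= -[leLHS]addr0; apply: lerD.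
    rewrite le_eqVlt; apply/orP; left; apply/eqP/eq_bigl => e.
    by rewrite /on; case: (e \in _).
  by apply: sumr_ge0.
elim: q u hq hu => [|y q IH] u /=; first by rewrite subrr normr0 => _ _; apply: sumr_ge0.
case/andP => /existsP[d /and3P[h1 /eqP h2 /eqP h3]] hq /andP[hu1 hu2].
have honD (r : seq (vert D)) : on r d.1 = [&& d.1 \in sedges S, src d \in r & src (opp_dart d) \in r].
  by rewrite /on; case: (d) => e []; rewrite /opp_dart //= [in RHS](andbC (_ \in r)).
rewrite (bigD1 d.1) /=; last by rewrite honD h1 h2 h3 !inE !eqxx ?orbT.
apply: le_trans (ler_distD (f y) _ _) _; apply: lerD.
  by rewrite edge_diff_dart h2 h3.
apply: le_trans (IH y hq hu2) _.
rewrite [leRHS](bigID (on (y :: q))) /= -[leLHS]addr0; apply: lerD; last by apply: sumr_ge0.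
rewrite le_eqVlt; apply/orP; left; apply/eqP/eq_bigl => e.
apply/idP/idP => [h|/andP[]//]; rewrite h andbT; apply/andP; split.
  by case/and3P: h => g1 g2 g3; rewrite /on g1 /= in_cons g2 in_cons g3 !orbT.
apply/eqP => he; move: h; rewrite he honD h2 => /and3P[_ h _]; by rewrite h in hu1.
Qed.

End Poincare.

(** The quadratic polynomial [\sum (a i * t + c i) ^+ 2] is nonnegative at its
    minimum. *)
Lemma cauchy_schwarz_sum (R : realFieldType) (I : finType) (P : pred I) (a c : I -> R) :
  (\sum_(i | P i) a i * c i) ^+ 2 <= (\sum_(i | P i) a i ^+ 2) * (\sum_(i | P i) c i ^+ 2).
Proof.
set A := \sum_(i | P i) a i ^+ 2; set C := \sum_(i | P i) c i ^+ 2; set B := \sum_(i | P i) _.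
have A0 : 0 <= A by apply: sumr_ge0 => i _; apply: sqr_ge0.
have hp t : 0 <= A * t ^+ 2 + B * t *+ 2 + C.
  have -> : A * t ^+ 2 + B * t *+ 2 + C = \sum_(i | P i) (a i * t + c i) ^+ 2.
    rewrite /A /B /C !mulr_suml -sumrMnl -!big_split; apply: eq_bigr => i _ /=; ring.
  by apply: sumr_ge0 => i _; apply: sqr_ge0.
have [A1|A1] := eqVneq A 0.
  have hz i : P i -> a i = 0.
    by move=> Pi; move/eqP: A1; rewrite psumr_eq0 => [/allP/(_ i)|j _]; rewrite ?sqr_ge0 // mem_index_enum Pi sqrf_eq0 => /(_ isT)/eqP.
  by rewrite A1 mul0r /B big1 ?expr0n //= => i /hz ->; rewrite mul0r.
have A2 : 0 < A by rewrite lt_neqAle eq_sym A1.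
(* The minimum of the polynomial is at [- B / A]. *)
have h := hp (- (B / A)); rewrite -subr_ge0.
have -> : A * C - B ^+ 2 = A * (A * (- (B / A)) ^+ 2 + B * (- (B / A)) *+ 2 + C).
  by field.
by rewrite mulr_ge0.
Qed.

(** * The spectral bound by filling length and area *)

Section FillingLengthArea.
Variables (R : realType) (D : disk_diagram).
Implicit Types (d : dart D) (v b : vert D) (s : dface D).

(** All 2-cell corners around an interior vertex are filled, since a dart with
    the unbounded region on its left starts at a boundary vertex. *)
Lemma int_not_bd v : v \in int_vertices D -> forall d, src d = v -> exists s, lface d = Some s.
Proof.
rewrite inE => /negP hv d hd; case E: (lface d) => [s|]; first by exists s.
case: hv; rewrite /bd_vertex /bvert inE /=; apply/orP; left; apply/existsP; exists d.
by rewrite hd eqxx andbT bdart_facing inE /facing E.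
Qed.

Lemma int_dart v : v \in int_vertices D -> exists d, src d = v.
Proof.
rewrite inE /bd_vertex /bvert inE /= negb_or => /andP[_ /forallPn[d]].
by rewrite negb_imply inE /= negbK => /eqP h; exists d.
Qed.

Lemma vol_eq (U : {set vert D}) :
  (\sum_(v in U) deg v)%N = #|[set d : dart D | src d \in U]|.
Proof.
rewrite -sum1_card (partition_big (@src D) (mem U)) /=; last by move=> d; rewrite inE.
apply: eq_bigr => v hv; rewrite /deg -sum1_card; apply: eq_bigl => d; rewrite !inE.
by case: eqP => [->|]; rewrite ?hv ?andbF.
Qed.

(** Volumes are compared with areas through the faces on the left of darts. *)
Lemma facing_le (A : {set dface D}) L : face_lengths_le D L ->
  (#|[set d : dart D | facing A d]| <= L * #|A|)%N.
Proof.
move=> hL; apply: (@leq_trans (\sum_(s in A) face_length s)%N); last first.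
  by rewrite mulnC -sum_nat_const; apply: leq_sum => s _; apply: hL.
rewrite -sum1_card big_mkcond /=.
under [leqRHS]eq_bigr => s _ do rewrite /face_length -sum1_card big_mkcond /=.
rewrite exchange_big /=; apply: leq_sum => d _; rewrite inE /facing.
case E: (lface d) => [s|] //; case: ifP => // hs.
by rewrite (bigD1 s) //= inE E eqxx.
Qed.

Lemma vol_le_area L : face_lengths_le D L ->
  (\sum_(v in int_vertices D) deg v <= L * area D)%N.
Proof.
move=> hL; rewrite vol_eq /area -cardsT; apply: leq_trans (facing_le setT hL).
apply/subset_leq_card/subsetP => d; rewrite !inE => hd.
have [|s hs] := @int_not_bd (src d) _ d erefl; first by rewrite inE.
by rewrite /facing hs inE.
Qed.

Lemma boundary_vertex_bound b (f : vert D -> R) v : bd_vertex b ->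
  (forall v, v \notin int_vertices D -> f v = 0) ->
  f v ^+ 2 <= (filling_length b)%:R * dirichlet_energy f.
Proof.
move=> hb hf; have [N [Sg [hsh ->]]] := filling_length_attained hb.
have fb : f b = 0 by apply: hf; rewrite inE negbK.
have E0 : 0 <= dirichlet_energy f by apply: sumr_ge0 => e _; apply: sqr_ge0.
have [->|hvb] := eqVneq v b; first by rewrite fb expr0n mulr_ge0.
have [j hj hc] := shelling_sweeps hsh hvb.
have := path_diff f hc; rewrite fb subr0 /= => hle.
have {hle} : f v ^+ 2 <= (\sum_(e in bd_edges (Sg j)) `|edge_diff f e|) ^+ 2.
  by rewrite -(real_normK (num_real (f v))) ler_pXn2r // nnegrE; apply: sumr_ge0.
move=> hle; apply: le_trans hle _.
have -> : \sum_(e in bd_edges (Sg j)) `|edge_diff f e| =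
    \sum_(e in bd_edges (Sg j)) 1 * `|edge_diff f e|.
  by apply: eq_bigr => e _; rewrite mul1r.
apply: le_trans (cauchy_schwarz_sum _ (fun=> 1) (fun e => `|edge_diff f e|)) _.
apply: ler_pM; try by apply: sumr_ge0 => e _; apply: sqr_ge0.
  rewrite (eq_bigr (fun=> 1)); last by move=> e _; rewrite expr1n.
  rewrite sumr_const ler_nat; apply: leq_trans (card_bd_edges _) _.
  have hj' : (j < N.+1)%N by [].
  exact: (leq_bigmax (Ordinal hj')).
rewrite /dirichlet_energy [leRHS](bigID (mem (bd_edges (Sg j)))) /= -[leLHS]addr0.
apply: lerD; last by apply: sumr_ge0 => e _; apply: sqr_ge0.
by apply: ler_sum => e _; rewrite real_normK ?num_real.
Qed.

Lemma weighted_mass_gt0 (f : vert D -> R) :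
  (forall v, v \notin int_vertices D -> f v = 0) -> (exists v, f v != 0) ->
  0 < weighted_mass f.
Proof.
move=> hf [v hv]; have vi : v \in int_vertices D.
  by apply/negPn/negP => /hf h; rewrite h eqxx in hv.
rewrite /weighted_mass (bigD1 v) //=; apply: ltr_pwDl.
  apply: mulr_gt0; last by rewrite exprn_even_gt0.
  have [d hd] := int_dart vi; rewrite ltr0n; apply/card_gt0P; exists d.
  by rewrite inE hd.
by apply: sumr_ge0 => u _; rewrite mulr_ge0 ?sqr_ge0.
Qed.

(** The set defining [lambda1] is nonempty (indicator of an interior vertex),
    so a Poincare inequality is a lower bound for its infimum. *)
Lemma lambda1_lb (c : R) : int_vertices D != set0 ->
  (forall f : vert D -> R, (forall v, v \notin int_vertices D -> f v = 0) ->
     (exists v, f v != 0) -> c * weighted_mass f <= dirichlet_energy f) ->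
  c <= lambda1 R D.
Proof.
move=> /set0Pn[v0 hv0] h; apply: lb_le_inf.
  pose f v : R := (v == v0)%:R.
  exists (dirichlet_energy f / weighted_mass f), f; split => //.
    by move=> v hv; rewrite /f; case: eqP => // hvv; rewrite hvv hv0 in hv.
  by exists v0; rewrite /f eqxx oner_eq0.
move=> q [f [h1 h2 ->]]; rewrite ler_pdivlMr; first exact: h.
exact: weighted_mass_gt0.
Qed.

Lemma area_gt0 : int_vertices D != set0 -> (0 < area D)%N.
Proof.
case/set0Pn => v hv; have [d hd] := int_dart hv; have [s _] := int_not_bd hv hd.
by apply/card_gt0P; exists s.
Qed.

Lemma perimeter_full : perimeter (full_subcx D) = #|[set d : dart D | lface d == None]|.
Proof.
by apply: eq_card => d; rewrite !inE bdart_facing inE /facing; case: (lface d) => [s|//]; rewrite inE.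
Qed.

Lemma perimeter_full_gt0 : int_vertices D != set0 -> (0 < perimeter (full_subcx D))%N.
Proof.
case/set0Pn => v hv; have [d hd] := int_dart hv.
have [|d0 h0] := @dd_outer D; first by apply/card_gt0P; exists d.1.
by rewrite perimeter_full; apply/card_gt0P; exists d0; rewrite inE h0.
Qed.

Lemma perimeter_le_filling_length b : bd_vertex b -> (perimeter (full_subcx D) <= filling_length b)%N.
Proof.
move=> /filling_length_attained[N [Sg [[h0 _ _ _] ->]]]; rewrite -h0.
exact: (leq_bigmax (@ord0 N)).
Qed.

Lemma filling_length_gt0 b : int_vertices D != set0 -> bd_vertex b -> (0 < filling_length b)%N.
Proof. by move=> h1 h2; apply: leq_trans (perimeter_full_gt0 h1) (perimeter_le_filling_length h2). Qed.

Lemma lambda1_ge_filling_length_area L b : int_vertices D != set0 -> face_lengths_le D L ->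
  bd_vertex b ->
  (L.+1%:R * ((filling_length b)%:R * (area D)%:R))^-1 <= lambda1 R D.
Proof.
move=> hi hL hb; apply: lambda1_lb => // f hf _.
have FL0 : 0 < (filling_length b)%:R :> R by rewrite ltr0n filling_length_gt0.
have A0 : 0 < (area D)%:R :> R by rewrite ltr0n area_gt0.
have P0 : 0 < L.+1%:R * ((filling_length b)%:R * (area D)%:R) :> R.
  by rewrite !mulr_gt0 // ltr0Sn.
rewrite mulrC ler_pdivrMr //.
apply: (@le_trans _ _ (\sum_(v in int_vertices D) (deg v)%:R * ((filling_length b)%:R * dirichlet_energy f))).
  by apply: ler_sum => v _; rewrite ler_wpM2l // boundary_vertex_bound.
have E0 : 0 <= dirichlet_energy f by apply: sumr_ge0 => e _; apply: sqr_ge0.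
rewrite -mulr_suml -natr_sum; apply: (@le_trans _ _ ((L.+1 * area D)%:R * ((filling_length b)%:R * dirichlet_energy f))).
  rewrite ler_wpM2r ?mulr_ge0 //.
  by rewrite ler_nat (leq_trans (vol_le_area hL)) // leq_mul2r leqnSn orbT.
by rewrite natrM le_eqVlt; apply/orP; left; apply/eqP; ring.
Qed.

End FillingLengthArea.

(** * Words, relators and combinatorial fillings *)

Section Words.
Local Open Scope nat_scope.
Variable P : presentation.
Notation W := (word (gens P)).
Implicit Types (u v w a c r : W) (x : letter (gens P)).

Lemma linvK x : linv (linv x) = x.
Proof. by case: x => g o; rewrite /linv /= negbK. Qed.

Lemma winvK w : winv (winv w) = w.
Proof. by rewrite /winv map_rev revK -map_comp map_id_in // => x _ /=; rewrite linvK. Qed.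

Lemma winv_cons x w : winv (x :: w) = winv w ++ [:: linv x].
Proof. by rewrite /winv /= rev_cons cats1. Qed.

Lemma group_eq_ctx a c u v : group_eq u v -> group_eq (a ++ u ++ c) (a ++ v ++ c).
Proof.
elim=> [w|w w' _|w1 w2 w3 _ h1 _ h2|w x w'|w r w' hr].
- exact: group_eq_refl.
- exact: group_eq_sym.
- exact: group_eq_trans h1 h2.
- have := group_eq_free (a ++ w) x (w' ++ c).
  by rewrite -!catA.
- have := group_eq_rel (a ++ w) (w' ++ c) hr.
  by rewrite -!catA.
Qed.

Lemma group_eq_catl a u v : group_eq u v -> group_eq (a ++ u) (a ++ v).
Proof. by move/(group_eq_ctx a [::]); rewrite !cats0. Qed.

Lemma group_eq_catr c u v : group_eq u v -> group_eq (u ++ c) (v ++ c).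
Proof. by move/(group_eq_ctx [::] c). Qed.

Lemma group_eq_winvr w : group_eq (w ++ winv w) [::].
Proof.
elim: w => [|x w IH]; first exact: group_eq_refl.
rewrite winv_cons; have := group_eq_ctx [:: x] [:: linv x] IH => /= h.
rewrite /= catA; apply: group_eq_trans h _.
exact: (group_eq_free [::] x [::]).
Qed.

Lemma group_eq_winvl w : group_eq (winv w ++ w) [::].
Proof. by have := group_eq_winvr (winv w); rewrite winvK. Qed.

(** Conjugation by [u]. *)
Lemma group_eq_swap u v : group_eq (u ++ v) [::] -> group_eq (v ++ u) [::].
Proof.
move=> h; apply: group_eq_trans (group_eq_winvl u).
apply: group_eq_trans (_ : group_eq (winv u ++ (u ++ v) ++ u) _).
  apply: group_eq_sym; have := group_eq_catr (v ++ u) (group_eq_winvl u).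
  by rewrite -!catA.
by have := group_eq_ctx (winv u) u h.
Qed.

Lemma group_eq_rot k w : group_eq w [::] <-> group_eq (rot k w) [::].
Proof. by rewrite -{1}(cat_take_drop k w); split; apply: group_eq_swap. Qed.

Lemma group_eq_cancel u v : group_eq (u ++ v) u -> group_eq v [::].
Proof.
move=> h; have h1 := group_eq_catl (winv u) h.
apply: group_eq_trans (group_eq_winvl u); apply: group_eq_trans h1.
rewrite catA; apply: group_eq_sym; exact: (group_eq_catr v (group_eq_winvl u)).
Qed.

(** The words read around a 2-cell, from any of its corners and in either
    direction. *)
Definition rel_word u : Prop :=
  exists r k, r \in rels P /\ (u = rot k r \/ u = rot k (winv r)).

Lemma group_eq_rel_word u : rel_word u -> group_eq u [::].
Proof.
case=> r [k [hr hu]]; have h1 : group_eq r [::].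
  by have := group_eq_rel [::] [::] hr; rewrite /= cats0.
case: hu => ->; apply: (iffLR (group_eq_rot k _)) => //.
apply: group_eq_trans (group_eq_winvl r); apply: group_eq_sym.
by have := group_eq_catl (winv r) h1; rewrite cats0.
Qed.

Lemma size_rel_word u : rel_word u -> 1 < size u.
Proof.
by case=> r [k [/pr_rels[_ h] [] ->]]; rewrite size_rot // /winv size_rev size_map.
Qed.

Lemma rel_word_rot u k : rel_word u -> rel_word (rot k u).
Proof.
have rr (s : W) i j : exists l, rot i (rot j s) = rot l s.
  by case: (leqP (size s) j) => hj; [exists i; rewrite (rot_oversize hj)|
   case: (leqP (size s) i) => hi; [exists j; rewrite (@rot_oversize _ i) // size_rot|
   rewrite rot_add_mod ?(ltnW hi) ?(ltnW hj) //; eexists]].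
case=> r [j [hr hu]].
case: hu => ->; [have [l ->] := rr r k j|have [l ->] := rr (winv r) k j];
  exists r, l; auto.
Qed.

(** The chord rule reads a diagram from inside to outside: the arc [u] of the
    boundary is covered by a new 2-cell whose remaining side is the single
    edge [x].  Restricting to a single edge avoids ever identifying boundary
    edges when derivations are turned into diagrams. *)
Inductive fill : nat -> W -> Prop :=
| fill_nil : fill 0 [::]
| fill_rot n k w : fill n w -> fill n (rot k w)
| fill_spur n x w : fill n w -> fill n (x :: linv x :: w)
| fill_chord n x u v : fill n (u ++ v) -> rel_word (linv x :: u) -> fill n.+1 (x :: v).

Lemma fill_unrot n k w : fill n (rot k w) -> fill n w.
Proof. by move/(fill_rot (size (rot k w) - k)); rewrite -[rot (_ - _) _]/(rotr k (rot k w)) rotK. Qed.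

Lemma chord_letter x u : rel_word (linv x :: u) -> group_eq u [:: x].
Proof.
move/group_eq_rel_word => h.
apply: group_eq_trans (_ : group_eq ([:: x; linv x] ++ u) _).
  exact/group_eq_sym/(group_eq_free [::]).
exact: (group_eq_catl [:: x] h).
Qed.

(** The easy half of the van Kampen lemma. *)
Lemma fill_trivial n w : fill n w -> group_eq w [::].
Proof.
elim=> {n w} [|n k w _ IH|n x w _ IH|n x u v _ IH hr].
- exact: group_eq_refl.
- exact: (iffLR (group_eq_rot k w)).
- exact: group_eq_trans (group_eq_free [::] x w) IH.
- apply: group_eq_trans IH; apply: group_eq_sym.
  exact: (group_eq_catr v (chord_letter hr)).
Qed.

End Words.

(** * From diagrams to fillings *)

Section Peel.
Local Open Scope nat_scope.
Variables (P : presentation) (D : disk_diagram) (lab : dart D -> letter (gens P)).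
Hypotheses (hlab : labelling lab) (hrel : faces_read_relators lab).
Implicit Types (d : dart D) (v b : vert D) (s : dface D) (S T : subcx D) (p q : seq (dart D)).

Fixpoint walk (u : vert D) p (v : vert D) : bool :=
  if p is d :: q then (src d == u) && walk (src (opp_dart d)) q v else u == v.

Lemma walk_cat u v p q : reflect (exists2 w, walk u p w & walk w q v) (walk u (p ++ q) v).
Proof.
elim: p u => [|d p IH] u /=.
  by apply: (iffP idP) => [h|[w /eqP -> //]]; exists u.
apply: (iffP andP) => [[h /IH[w h1 h2]]|[w /andP[h h1] h2]]; first by exists w; rewrite ?h.
by split=> //; apply/IH; exists w.
Qed.

(** Any closed walk running once along every outward side of [S] will do as
    boundary walk: it reads a word that local surgery turns into the next one. *)
Definition bd_walk S p : Prop :=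
  [/\ uniq p, (forall d, (d \in p) = bdart S d) & exists u, walk u p u].

Lemma bd_walk_rot S p i : bd_walk S p -> bd_walk S (rot i p).
Proof.
case=> h1 h2 [u hu]; split; first by rewrite rot_uniq.
  by move=> d; rewrite mem_rot h2.
move: hu; rewrite -{1}(cat_take_drop i p) => /walk_cat[w w1 w2].
by exists w; apply/walk_cat; exists u.
Qed.

Lemma walk_orbit d : walk (src d) (orbit (@fsucc D) d) (src d).
Proof.
have key n e : walk (src e) (traject (@fsucc D) e n) (src (iter n (@fsucc D) e)).
  elim: n e => [|n IH] e /=; first by rewrite eqxx.
  by rewrite eqxx -src_fsucc -iterS iterSr; apply: IH.
by have := key (order (@fsucc D) d) d; rewrite iter_order //; apply: dd_fsucc_inj.
Qed.

Lemma mem_orbit_face d d' : (d' \in orbit (@fsucc D) d) = (lface d' == lface d).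
Proof.
by rewrite -fconnect_orbit; apply/idP/eqP => [/dd_faceP ->|/esym/dd_faceP].
Qed.

Lemma orbit_cons d : orbit (@fsucc D) d = d :: behead (orbit (@fsucc D) d).
Proof. by rewrite /orbit; case: (order _ _) (order_gt0 (@fsucc D) d). Qed.

(** The exposed edge is replaced by the rest of the boundary of the 2-cell. *)
Lemma bd_walk_del_face S s d p : subcx_closed S -> free_side S s d ->
  bd_walk S (opp_dart d :: p) ->
  bd_walk (del_face S s d.1) (behead (orbit (@fsucc D) d) ++ p).
Proof.
move=> [_ hc] hs [h1 h2 [u /= /andP[/eqP hu1 hu2]]].
have [g1 g2 g3] := hs.
have /andP[nu1 nu2] : uniq (d :: behead (orbit (@fsucc D) d)).
  by rewrite -orbit_cons orbit_uniq.
have in_orb e : (e \in behead (orbit (@fsucc D) d)) = (e != d) && (lface e == Some s).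
  have := mem_orbit_face d e; rewrite orbit_cons in_cons g1 => <-.
  by case: eqVneq => [->|] //=; rewrite (negbTE nu1).
have in_p e : (e \in p) = (e != opp_dart d) && bdart S e.
  have := h2 e; rewrite in_cons => <-.
  by case: eqVneq => [->|] //=; case/andP: h1 => h _; apply/negbTE.
split.
- rewrite cat_uniq; apply/and3P; split=> //; last by case/andP: h1.
  apply/hasPn => e; rewrite in_p in_orb bdart_facing => /andP[_ /andP[_ h]].
  by apply: contra h => /andP[_ /eqP h]; rewrite /facing h.
- move=> e; rewrite mem_cat in_orb in_p !bdart_facing in_setD1.
  have [he|he] := eqVneq (lface e) (Some s).
    rewrite /facing he g2 in_setD1 eqxx /= !andbF orbF !andbT (hc e s) // andbT.
    congr (~~ _); apply/eqP/eqP => [->//|]; exact: free_side_uniq hs he.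
  rewrite andbF /=; have -> : facing (sfaces S :\ s) e = facing (sfaces S) e.
    rewrite /facing; case: (lface e) he => // s' hs'; rewrite in_setD1.
    by have -> : s' != s by apply: contra hs' => /eqP ->.
  rewrite andbA; congr (_ && _ && _); congr (~~ _); apply/eqP/eqP => [->//|].
  by case/dart_same_edge => // h; rewrite h g1 eqxx in he.
- exists u; apply/walk_cat; exists (src d); last by move: hu2; rewrite opp_dartK.
  by move: (walk_orbit d); rewrite orbit_cons /= eqxx -hu1.
Qed.

(** The only way out of the tip of a leaf is back along the same edge, so the
    two darts are consecutive. *)
Lemma bd_walk_del_leaf S d p : free_leaf S d -> bd_walk S (opp_dart d :: p) ->
  exists2 q, p = d :: q & bd_walk (del_leaf S d) q.
Proof.
move=> [l1 l2 l3] [h1 h2 [u /= /andP[/eqP hu1 hu2]]].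
have dp : d \in p.
  by have := h2 d; rewrite in_cons eq_sym (negbTE (opp_dart_neq d)) /= => ->.
case: p h1 h2 hu2 dp => // d' q h1 h2 /= /andP[/eqP k1 k2] _.
have hd : d' = d.
  apply: l3; last by rewrite k1 opp_dartK.
  have : bdart S d' by have := h2 d'; rewrite !in_cons eqxx orbT.
  by case/andP.
rewrite hd in h1 h2 k1 k2 *; exists q => //; split.
- by case/and3P: h1.
- move=> e; rewrite bdart_facing /= in_setD1.
  have := h2 e; rewrite !in_cons bdart_facing -andbA => <-.
  have [he|he] := eqVneq e.1 d.1.
    case/dart_same_edge: he => -> /=; case/and3P: h1; rewrite in_cons negb_or => /andP[_ /negbTE f1] /negbTE f2 _.
      by rewrite f2.
    by rewrite f1.
  have -> : e == opp_dart d = false by apply/eqP => h; rewrite h eqxx in he.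
  by have -> : e == d = false by apply/eqP => h; rewrite h eqxx in he.
- by exists u; rewrite hu1 in k2.
Qed.

(** The number counts the removed 2-cells, that is, the relators spent. *)
Inductive peel (S0 : subcx D) : subcx D -> nat -> Prop :=
| peel_start : peel S0 S0 0
| peel_face S n s d : peel S0 S n -> free_side S s d -> peel S0 (del_face S s d.1) n.+1
| peel_leaf S n d : peel S0 S n -> free_leaf S d -> peel S0 (del_leaf S d) n.

Lemma peel_disk S0 S n : subcx_disk S0 -> peel S0 S n ->
  subcx_disk S /\ #|sfaces S| + n = #|sfaces S0|.
Proof.
move=> h0; elim=> {S n} [|S n s d _ [[h1 h2 h3] h4] hs|S n d _ [[h1 h2 h3] h4] hl].
- by split; rewrite ?addn0.
- have [g1 g2] := del_face_disk h1 h2 hs; have [g3 g4] := card_del_face h1 hs.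
  split; last by move: h4; rewrite g4 /=; lia.
  by split=> //; move: h3; rewrite g3 g4 /=; lia.
- have [g1 g2] := del_leaf_disk h1 h2 hl; have [g3 g4] := card_del_leaf h1 hl.
  by split=> //; split=> //; move: h3; rewrite g3 g4 /=; lia.
Qed.

(** Collapses are exactly the rules of [fill] read backwards. *)
Lemma peel_fill S0 p0 S n : subcx_disk S0 -> bd_walk S0 p0 -> peel S0 S n ->
  exists p, bd_walk S p /\
    forall m, fill m (map lab p) -> fill (m + n) (map lab p0).
Proof.
move=> h0 hp0; elim=> {S n} [|S n s d hS [p [hp hf]] hs|S n d hS [p [hp hf]] hl].
- by exists p0; split=> // m; rewrite addn0.
- have [[h1 h2 h3] _] := peel_disk h0 hS.
  have hd : opp_dart d \in p.
    by case: hp => _ -> _; case: hs.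
  have [i q hq] := rot_to hd; have := bd_walk_rot i hp; rewrite hq => hpq.
  exists (behead (orbit (@fsucc D) d) ++ q); split; first exact: bd_walk_del_face.
  move=> m hm; rewrite addnS -addSn; apply: hf; apply: (@fill_unrot _ _ i).
  rewrite -map_rot hq /=; apply: fill_chord (map lab (behead (orbit (@fsucc D) d))) _ _ _.
    by rewrite -map_cat.
  rewrite hlab linvK -[_ :: _]/(map lab (d :: _)) -orbit_cons.
  by apply: hrel; case: hs => ->.
- have hd : opp_dart d \in p.
    by case: hp => _ -> _; case: hl.
  have [i q hq] := rot_to hd; have := bd_walk_rot i hp; rewrite hq => hpq.
  have [q' hq' hw] := bd_walk_del_leaf hl hpq; exists q'; split=> // m hm.
  apply: hf; apply: (@fill_unrot _ _ i); rewrite -map_rot hq hq' /=.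
  by rewrite hlab -{2}[lab d]linvK; apply: fill_spur.
Qed.

(** Same strategy as for based shellings. *)
Lemma peel_to_edgeless S0 S n : subcx_disk S0 -> peel S0 S n ->
  exists2 T, peel S0 T #|sfaces S0| & sedges T = set0.
Proof.
move=> h0; have [k] := ubnP #|sedges S|; elim: k S n => // k IH S n hk hS.
have [[h1 h2 h3] h4] := peel_disk h0 hS.
have [hF|hF] := eqVneq (sfaces S) set0; last first.
  have [s [d hs]] := exposed_face h1 hF.
  have [g3 _] := card_del_face h1 hs.
  by apply: IH (peel_face hS hs); move: hk; rewrite g3; lia.
have [hE|hE] := eqVneq (sedges S) set0.
  by exists S => //; rewrite -h4 hF cards0.
rewrite hF cards0 in h3; have hE0 : 0 < #|sedges S| by rewrite card_gt0.
have [b hb] : exists b, b \in sverts S by apply/card_gt0P; lia.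
have hlt : #|sedges S| < #|sverts S| by lia.
have hV : 1 < #|sverts S| by lia.
have [d [k1 k2 k3]] := leaf_exists h1 h2 hlt hb hV.
have hl := leaf_faceless hF k1 k3; have [g3 _] := card_del_leaf h1 hl.
by apply: IH (peel_leaf hS hl); move: hk; rewrite g3; lia.
Qed.

Lemma bd_walk_full d : lface d = None -> bd_walk (full_subcx D) (orbit (@fsucc D) d).
Proof.
move=> h; split; first exact: orbit_uniq; last by exists (src d); apply: walk_orbit.
move=> e; rewrite mem_orbit_face h bdart_facing inE /= /facing.
by case: (lface e) => //= s; rewrite inE.
Qed.

Lemma size_bd_walk S p : bd_walk S p -> size p = perimeter S.
Proof.
case=> h1 h2 _; rewrite -(card_uniqP h1) /perimeter; apply: eq_card => d.
by rewrite h2 inE.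
Qed.

Lemma bd_walk_fill S p : subcx_disk S -> bd_walk S p -> fill #|sfaces S| (map lab p).
Proof.
move=> hS hp; have [T hT hE] := peel_to_edgeless hS (peel_start S).
have [q [hq hf]] := peel_fill hS hp hT; rewrite -[#|_|]add0n; apply: hf.
suff -> : q = [::] by exact: fill_nil.
case: hq => _ h _; case: q h => // d q /(_ d).
by rewrite in_cons eqxx bdart_facing hE inE.
Qed.

Lemma diagram_fill w : boundary_reads lab w -> fill (area D) w.
Proof.
case=> [[hE0 ->]|[d [hd ->]]].
  have -> : area D = 0; last exact: fill_nil.
  apply/eqP; rewrite eqn0Ngt; apply/negP => /card_gt0P[s _].
  have [d _] := dd_face_surj s; have : 0 < #|edge D| by apply/card_gt0P; exists d.1.
  by rewrite hE0.
have := bd_walk_fill (full_disk D) (bd_walk_full hd).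
by rewrite /= cardsT.
Qed.

End Peel.

(** * Adding a chord in the unbounded region *)

Section AddChord.
Local Open Scope nat_scope.
Variables (D : disk_diagram) (d0 : dart D) (k : nat).
Let f := @fsucc D.
Let m := order f d0.
Let dk := iter k f d0.
Let a := iter m.-1 f d0.
Let c := iter k.-1 f d0.
Hypotheses (h0 : lface d0 = None) (hk : 0 < k < m) (hne : src d0 != src dk).

(** [None] is the new edge: [ep] runs from the source of [d0] to that of [dk]
    with the unbounded region on its left, and [em] runs back with the new
    2-cell on its left.  The new 2-cell is bounded by [em] and the first [k]
    darts of the outer boundary starting at [d0]. *)
Definition chord_dart := (option (edge D) * bool)%type.
Definition chord_inj (d : dart D) : chord_dart := (Some d.1, d.2).
Let ep : chord_dart := (None, true).
Let em : chord_dart := (None, false).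

Definition chord_fsucc (y : chord_dart) : chord_dart :=
  match y with
  | (Some e, o) => if (e, o) == a then ep else if (e, o) == c then em
                   else chord_inj (f (e, o))
  | (None, true) => chord_inj dk
  | (None, false) => chord_inj d0
  end.
Definition chord_src (y : chord_dart) : vert D :=
  match y with
  | (Some e, o) => src (e, o)
  | (None, true) => src d0
  | (None, false) => src dk
  end.
Definition chord_lface (y : chord_dart) : option (option (dface D)) :=
  match y with
  | (Some e, o) => if (e, o) \in traject f d0 k then Some None else omap Some (lface (e, o))
  | (None, true) => None
  | (None, false) => Some None
  end.

Let chord_injI : injective chord_inj.
Proof. by move=> [e o] [e' o'] [-> ->]. Qed.

Let k_gt0 : 0 < k. Proof. by case/andP: hk. Qed.
Let k_ltm : k < m. Proof. by case/andP: hk. Qed.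
Let m_gt0 : 0 < m. Proof. exact: ltn_trans k_gt0 k_ltm. Qed.

Let it_inj i j : i < m -> j < m -> iter i f d0 = iter j f d0 -> i = j.
Proof. exact: iter_order_inj. Qed.

Let fa : f a = d0.
Proof. by rewrite /a -iterS prednK // iter_order //; apply: dd_fsucc_inj. Qed.
Let fc : f c = dk.
Proof. by rewrite /c -iterS prednK. Qed.
Let ca : c == a = false.
Proof. apply/eqP => /it_inj; lia. Qed.

Let lf i : lface (iter i f d0) = None.
Proof. by rewrite lface_iter. Qed.

Let fs_a : chord_fsucc (chord_inj a) = ep.
Proof. by rewrite /chord_fsucc /chord_inj -surjective_pairing eqxx. Qed.
Let fs_c : chord_fsucc (chord_inj c) = em.
Proof. by rewrite /chord_fsucc /chord_inj -surjective_pairing eqxx ca. Qed.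
Let fs_o d : d != a -> d != c -> chord_fsucc (chord_inj d) = chord_inj (f d).
Proof. by rewrite /chord_fsucc /chord_inj -surjective_pairing => /negbTE -> /negbTE ->. Qed.

Variant chord_spec : chord_dart -> Type :=
| ChordA : chord_spec (chord_inj a)
| ChordC : chord_spec (chord_inj c)
| ChordO d : d != a -> d != c -> chord_spec (chord_inj d)
| ChordP : chord_spec ep
| ChordM : chord_spec em.

Let chordP y : chord_spec y.
Proof.
case: y => [[e|] o]; last by case: o; constructor.
rewrite -[(Some e, o)]/(chord_inj (e, o)).
have [->|h1] := eqVneq (e, o) a; first by constructor.
by have [->|h2] := eqVneq (e, o) c; constructor.
Qed.

Lemma chord_fsucc_inj : injective chord_fsucc.
Proof.
have fi := @dd_fsucc_inj D.
have ne1 d : d != a -> chord_inj (f d) <> chord_inj d0.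
  by move=> /eqP h /chord_injI; rewrite -fa => /fi.
have ne2 d : d != c -> chord_inj (f d) <> chord_inj dk.
  by move=> /eqP h /chord_injI; rewrite -fc => /fi.
have ne3 : chord_inj d0 <> chord_inj dk.
  by move=> /chord_injI h; move: hne; rewrite -h eqxx.
move=> x y; case: (chordP x) => [||d n1 n2||]; case: (chordP y) => [||d' n1' n2'||];
  rewrite ?fs_a ?fs_c ?fs_o //=.
- by move/chord_injI/fi ->.
- by move/(ne2 _ n2).
- by move/(ne1 _ n1).
- by move/esym/(ne2 _ n2').
- by move/esym/ne3.
- by move/esym/(ne1 _ n1').
Qed.

(** The new darts are inserted into the rotations at the two ends, so every
    old step around a vertex is still realised, possibly through a new dart. *)
Lemma chord_vertP x y :
  chord_src x = chord_src y <-> fconnect (fun x => chord_fsucc (opp_dart x)) x y.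
Proof.
set sg := fun x => _.
have oppi d : opp_dart (chord_inj d) = chord_inj (opp_dart d) by case: d.
have srci d : chord_src (chord_inj d) = src d by case: d.
have sg_inj : injective sg.
  by move=> u v /chord_fsucc_inj /(congr1 (@opp_dart _)); case: u v => [? ?] [? ?]; rewrite /opp_dart /= !negbK.
have inv u : chord_src (chord_fsucc u) = chord_src (opp_dart u).
  case: (chordP u) => [||d n1 n2||]; rewrite ?fs_a ?fs_c ?fs_o // ?oppi ?srci //=.
  - by rewrite -fa src_fsucc.
  - by rewrite -fc src_fsucc.
  - by rewrite src_fsucc.
split; last first.
  move/iter_findex => <-; elim: (findex _ _ _) => //= n ->; rewrite inv.
  by case: (iter n sg x) => e o; rewrite /opp_dart /= negbK.
have sgp : sg ep = chord_inj d0 by [].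
have sgm : sg em = chord_inj dk by [].
have sim d : fconnect sg (chord_inj d) (chord_inj (f (opp_dart d))).
  have e1 : sg (chord_inj d) = chord_fsucc (chord_inj (opp_dart d)) by rewrite /sg oppi.
  have [h|n1] := eqVneq (opp_dart d) a.
    rewrite h fs_a in e1; rewrite h fa -sgp -e1.
    exact: connect_trans (fconnect1 _ _) (fconnect1 _ _).
  have [h|n2] := eqVneq (opp_dart d) c.
    rewrite h fs_c in e1; rewrite h fc -sgm -e1.
    exact: connect_trans (fconnect1 _ _) (fconnect1 _ _).
  by rewrite -fs_o // -e1; exact: fconnect1.
have old d d' : src d = src d' -> fconnect sg (chord_inj d) (chord_inj d').
  move/dd_vertP; apply: connect_map => u v /eqP <-; exact: sim.
have red u : exists2 d, fconnect sg u (chord_inj d) & src d = chord_src u.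
  case: u => [[e|] o]; first by exists (e, o).
  by case: o; [exists d0|exists dk] => //; [rewrite -sgp|rewrite -sgm]; apply: fconnect1.
have [d h1 <-] := red x; have [d' h2 <-] := red y => /old h3.
apply: connect_trans h1 (connect_trans h3 _).
by rewrite (fconnect_sym sg_inj).
Qed.

Let lfi d : chord_lface (chord_inj d) =
  if d \in traject f d0 k then Some None else omap Some (lface d).
Proof. by case: d. Qed.

Let traj_lt d : reflect (exists2 i, i < k & d = iter i f d0) (d \in traject f d0 k).
Proof. exact: trajectP. Qed.

Let outer d : lface d = None -> exists2 i, i < m & d = iter i f d0.
Proof.
rewrite -h0 => /esym/dd_faceP h; exists (findex f d0 d); first exact: findex_max.
by rewrite iter_findex.
Qed.

(** Away from the outer walk nothing changes, and the outer walk is cut into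
    the first [k] darts closed up by [em] and the others closed up by [ep]. *)
Lemma chord_faceP x y : chord_lface x = chord_lface y <-> fconnect chord_fsucc x y.
Proof.
have nk i : k <= i < m -> iter i f d0 \in traject f d0 k = false.
  by move=> hi; apply/negP => /traj_lt[j hj] /it_inj; lia.
have yk i : i < k -> iter i f d0 \in traject f d0 k.
  by move=> hi; apply/traj_lt; exists i.
have inv u : chord_lface (chord_fsucc u) = chord_lface u.
  case: (chordP u) => [||d n1 n2||]; rewrite ?fs_a ?fs_c ?fs_o ?lfi //=.
  - rewrite /a nk ?lf //; lia.
  - by rewrite /c yk // ltn_predL.
  - have -> : (f d \in traject f d0 k) = (d \in traject f d0 k).
      apply/traj_lt/traj_lt => -[i hi hd].
        case: i hi hd => [|i] hi hd; last by exists i; [exact: ltnW|exact: (@dd_fsucc_inj D)].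
        by case/eqP: n1; apply: (@dd_fsucc_inj D); rewrite -/f hd fa.
      exists i.+1; last by rewrite hd.
      rewrite ltn_neqAle hi andbT; apply/eqP => hik; case/eqP: n2.
      by rewrite hd /c -hik.
    by rewrite lface_fsucc.
  - rewrite /dk nk ?lf //; lia.
  - by rewrite (yk 0).
split; last by move/iter_findex => <-; elim: (findex _ _ _) => //= n ->; rewrite inv.
have stp i : i.+1 < k \/ k <= i /\ i.+1 < m -> chord_fsucc (chord_inj (iter i f d0)) = chord_inj (iter i.+1 f d0).
  by move=> hi; rewrite fs_o //; apply/eqP => /it_inj; lia.
have cb i : i < k -> fconnect chord_fsucc em (chord_inj (iter i f d0)).
  elim: i => [|i IH] hi; first exact: (fconnect1 _ em).
  apply: connect_trans (IH (ltnW hi)) _; rewrite -stp; [exact: fconnect1 | by left].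
have cv i : i < m - k -> fconnect chord_fsucc ep (chord_inj (iter (i + k) f d0)).
  elim: i => [|i IH] hi; first exact: (fconnect1 _ ep).
  apply: connect_trans (IH (ltnW hi)) _; rewrite addSn -stp; [exact: fconnect1 | right; lia].
have co d d' s : lface d = Some s -> fconnect f d d' -> fconnect chord_fsucc (chord_inj d) (chord_inj d').
  move=> hd /iter_findex <-; elim: (findex _ _ _) => //= n IH.
  have hn : lface (iter n f d) = Some s by rewrite lface_iter.
  apply: connect_trans IH _; rewrite -fs_o; first exact: fconnect1.
    by apply/eqP => h; move: hn; rewrite h lf.
  by apply/eqP => h; move: hn; rewrite h lf.
have fsy := fconnect_sym chord_fsucc_inj.
have cls u : match chord_lface u with
   | None => fconnect chord_fsucc ep u
   | Some None => fconnect chord_fsucc em u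
   | Some (Some s) => exists2 d, u = chord_inj d & lface d = Some s
   end.
  case: u => [[e|] o]; last by case: o; apply: connect0.
  rewrite -[(Some e, o)]/(chord_inj (e, o)) lfi; case: traj_lt => [[i hi ->]|hno]; first exact: cb.
  case E: (lface (e, o)) => [s|] /=; first by exists (e, o).
  have [i hi hd] := outer E; rewrite hd.
  have [hik|hik] := ltnP i k; first by case: hno; exists i.
  by rewrite -(subnK hik); apply: cv; lia.
move=> hxy; move: (cls x) (cls y); rewrite hxy; case: (chord_lface y) => [[s|]|].
- case=> d -> h1 [d' -> h2]; apply: (co _ _ _ h1); apply/dd_faceP; by rewrite h1 h2.
- by move=> h1 h2; apply: connect_trans h2; rewrite fsy.
- by move=> h1 h2; apply: connect_trans h2; rewrite fsy.
Qed.

Definition chord_diagram : disk_diagram.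
Proof.
refine (@DiskDiagram (vert D) (option (edge D)) (option (dface D)) chord_src chord_fsucc
  chord_lface chord_fsucc_inj chord_vertP chord_faceP _ _ _ _ _).
- case=> [s|]; last by exists em.
  have [d hd] := dd_face_surj s; exists (chord_inj d); rewrite lfi hd.
  by case: traj_lt => // -[i _ hi]; move: hd; rewrite hi lf.
- by move=> _; exists ep.
- move=> u v; have := dd_connected u v; apply: (@connect_map _ _ _ _ id) => x y.
  case/existsP=> -[e o] h; apply: connect1; apply/existsP; by exists (Some e, o).
- by case=> [[e|] [] ] /=; [apply: (dd_noloop (e, true)) | apply: (dd_noloop (e, false)) | | rewrite eq_sym].
- by rewrite !card_option addnS dd_euler.
Defined.

Section Labels.
Variables (P : presentation) (lab : dart D -> letter (gens P)) (x : letter (gens P)).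

Definition chord_lab (y : chord_dart) : letter (gens P) :=
  match y with (Some e, o) => lab (e, o) | (None, true) => x | (None, false) => linv x end.

Let labi d : chord_lab (chord_inj d) = lab d. Proof. by case: d. Qed.

Lemma chord_labelling : labelling lab -> @labelling P chord_diagram chord_lab.
Proof.
move=> hl [[e|] o]; first exact: (hl (e, o)).
by case: o => //; exact/esym/linvK.
Qed.

Lemma read_chord_face :
  @read_from P chord_diagram chord_lab em = linv x :: map lab (traject f d0 k).
Proof.
rewrite /read_from (@orbit_fcycle _ _ em (map chord_inj (traject f d0 k))).
- by rewrite /= -map_comp; congr (_ :: _); apply: eq_map => d /=; apply: labi.
- rewrite /= map_inj_uniq //; apply/andP; split; first by apply/mapP => -[].
  have := orbit_uniq f d0; rewrite /orbit -/m -(subnKC (ltnW k_ltm)) trajectD cat_uniq.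
  by case/andP.
- have -> : traject f d0 k = d0 :: traject f (f d0) k.-1 by rewrite -trajectS prednK.
  rewrite /= rcons_path /= eqxx /= last_map last_traject; apply/andP; split; last first.
    by apply/eqP; exact: fs_c.
  apply: (@fpath_image _ _ f) => i hi.
  by apply: fs_o; apply/eqP => /it_inj; move: k_ltm; lia.
Qed.

Lemma read_chord_outer :
  @read_from P chord_diagram chord_lab ep = x :: map lab (traject f dk (m - k)).
Proof.
rewrite /read_from (@orbit_fcycle _ _ ep (map chord_inj (traject f dk (m - k)))).
- by rewrite /= -map_comp; congr (_ :: _); apply: eq_map => d /=; apply: labi.
- rewrite /= map_inj_uniq //; apply/andP; split; first by apply/mapP => -[].
  have := orbit_uniq f d0; rewrite /orbit -/m -{1}(subnKC (ltnW k_ltm)) trajectD cat_uniq.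
  by case/and3P.
- rewrite /= rcons_path; case E: (m - k) => [|n]; first by move: k_ltm E; lia.
  rewrite trajectS /= eqxx /= last_map last_traject; apply/andP; split; last first.
    have -> : iter n f dk = a by rewrite /dk /a -iterD; congr iter; lia.
    by apply/eqP; exact: fs_a.
  apply: (@fpath_image _ _ f) => i hi; rewrite /dk -!iterD.
  by apply: fs_o; apply/eqP => /it_inj; move: k_ltm; lia.
Qed.

Lemma read_chord_old d s : lface d = Some s ->
  @read_from P chord_diagram chord_lab (chord_inj d) = read_from lab d.
Proof.
move=> hd; rewrite /read_from (@orbit_image _ _ f chord_fsucc chord_inj) //.
  by rewrite -map_comp; apply: eq_map => e /=; apply: labi.
move=> n; have hn : lface (iter n f d) = Some s by rewrite lface_iter.
by rewrite fs_o //; apply/eqP => h; move: hn; rewrite h lf.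
Qed.

End Labels.
End AddChord.

(** * Adding a spur in the unbounded region *)

Section AddSpur.
Local Open Scope nat_scope.
Variables (D : disk_diagram) (d0 : dart D).
Let f := @fsucc D.
Let m := order f d0.
Let a := iter m.-1 f d0.
Hypotheses (h0 : lface d0 = None).

(** [None] is the new edge: [ep] leaves the boundary vertex and [em] comes
    back from the tip, which is the new vertex [None]. *)
Definition spur_dart := (option (edge D) * bool)%type.
Definition spur_inj (d : dart D) : spur_dart := (Some d.1, d.2).
Let ep : spur_dart := (None, true).
Let em : spur_dart := (None, false).

Definition spur_fsucc (y : spur_dart) : spur_dart :=
  match y with
  | (Some e, o) => if (e, o) == a then ep else spur_inj (f (e, o))
  | (None, true) => em
  | (None, false) => spur_inj d0
  end.
Definition spur_src (y : spur_dart) : option (vert D) :=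
  match y with
  | (Some e, o) => Some (src (e, o))
  | (None, true) => Some (src d0)
  | (None, false) => None
  end.
Definition spur_lface (y : spur_dart) : option (dface D) :=
  if y is (Some e, o) then lface (e, o) else None.

Let spur_injI : injective spur_inj.
Proof. by move=> [e o] [e' o'] [-> ->]. Qed.

Let m_gt0 : 0 < m. Proof. exact: order_gt0. Qed.

Let it_inj i j : i < m -> j < m -> iter i f d0 = iter j f d0 -> i = j.
Proof. exact: iter_order_inj. Qed.

Let fa : f a = d0.
Proof. by rewrite /a -iterS prednK // iter_order //; apply: dd_fsucc_inj. Qed.

Let lf i : lface (iter i f d0) = None.
Proof. by rewrite lface_iter. Qed.

Let fs_a : spur_fsucc (spur_inj a) = ep.
Proof. by rewrite /spur_fsucc /spur_inj -surjective_pairing eqxx. Qed.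
Let fs_o d : d != a -> spur_fsucc (spur_inj d) = spur_inj (f d).
Proof. by rewrite /spur_fsucc /spur_inj -surjective_pairing => /negbTE ->. Qed.

Variant spur_spec : spur_dart -> Type :=
| SpurA : spur_spec (spur_inj a)
| SpurO d : d != a -> spur_spec (spur_inj d)
| SpurP : spur_spec ep
| SpurM : spur_spec em.

Let spurP y : spur_spec y.
Proof.
case: y => [[e|] o]; last by case: o; constructor.
rewrite -[(Some e, o)]/(spur_inj (e, o)).
by have [->|h1] := eqVneq (e, o) a; constructor.
Qed.

Lemma spur_fsucc_inj : injective spur_fsucc.
Proof.
have fi := @dd_fsucc_inj D.
have ne1 d : d != a -> spur_inj (f d) <> spur_inj d0.
  by move=> /eqP h /spur_injI; rewrite -fa => /fi.
move=> x y; case: (spurP x) => [|d n1||]; case: (spurP y) => [|d' n1'||];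
  rewrite ?fs_a ?fs_o //=.
- by move/spur_injI/fi ->.
- by move/(ne1 _ n1).
- by move/esym/(ne1 _ n1').
Qed.

(** The tip carries only [em]; elsewhere every old step around a vertex is
    still realised, possibly through [ep]. *)
Lemma spur_vertP x y :
  spur_src x = spur_src y <-> fconnect (fun x => spur_fsucc (opp_dart x)) x y.
Proof.
set sg := fun x => _.
have oppi d : opp_dart (spur_inj d) = spur_inj (opp_dart d) by case: d.
have srci d : spur_src (spur_inj d) = Some (src d) by case: d.
have sg_inj : injective sg.
  by move=> u v /spur_fsucc_inj /(congr1 (@opp_dart _)); case: u v => [? ?] [? ?]; rewrite /opp_dart /= !negbK.
have inv u : spur_src (spur_fsucc u) = spur_src (opp_dart u).
  case: (spurP u) => [|d n1||]; rewrite ?fs_a ?fs_o // ?oppi ?srci //=.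
  - by rewrite -fa src_fsucc.
  - by rewrite src_fsucc.
split; last first.
  move/iter_findex => <-; elim: (findex _ _ _) => //= n ->; rewrite inv.
  by case: (iter n sg x) => e o; rewrite /opp_dart /= negbK.
have sgp : sg ep = spur_inj d0 by [].
have sim d : fconnect sg (spur_inj d) (spur_inj (f (opp_dart d))).
  have e1 : sg (spur_inj d) = spur_fsucc (spur_inj (opp_dart d)) by rewrite /sg oppi.
  have [h|n1] := eqVneq (opp_dart d) a.
    rewrite h fs_a in e1; rewrite h fa -sgp -e1.
    exact: connect_trans (fconnect1 _ _) (fconnect1 _ _).
  by rewrite -fs_o // -e1; exact: fconnect1.
have old d d' : src d = src d' -> fconnect sg (spur_inj d) (spur_inj d').
  move/dd_vertP; apply: connect_map => u v /eqP <-; exact: sim.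
have red u : u = em \/ exists2 d, fconnect sg u (spur_inj d) & Some (src d) = spur_src u.
  case: u => [[e|] o]; first by right; exists (e, o).
  by case: o; [right; exists d0 => //; rewrite -sgp; apply: fconnect1 | left].
case: (red x) (red y) => [->|[d h1 <-]] [->|[d' h2 <-]] //.
move=> [] /old h3; apply: connect_trans h1 (connect_trans h3 _).
by rewrite (fconnect_sym sg_inj).
Qed.

Let lfi d : spur_lface (spur_inj d) = lface d.
Proof. by case: d. Qed.

(** The outer walk makes a detour through [ep] and [em]. *)
Lemma spur_faceP x y : spur_lface x = spur_lface y <-> fconnect spur_fsucc x y.
Proof.
have inv u : spur_lface (spur_fsucc u) = spur_lface u.
  case: (spurP u) => [|d n1||]; rewrite ?fs_a ?fs_o ?lfi //=.
  - by rewrite lf.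
  - by rewrite lface_fsucc.
split; last by move/iter_findex => <-; elim: (findex _ _ _) => //= n ->; rewrite inv.
have sim d : fconnect spur_fsucc (spur_inj d) (spur_inj (f d)).
  have [->|n1] := eqVneq d a; last by rewrite -fs_o //; apply: fconnect1.
  rewrite fa; apply: connect_trans (fconnect1 _ _) _; rewrite fs_a.
  exact: connect_trans (fconnect1 _ ep) (fconnect1 _ em).
have old d d' : lface d = lface d' -> fconnect spur_fsucc (spur_inj d) (spur_inj d').
  move/dd_faceP; apply: connect_map => u v /eqP <-; exact: sim.
have red u : exists2 d, fconnect spur_fsucc u (spur_inj d) & lface d = spur_lface u.
  case: u => [[e|] o]; first by exists (e, o).
  case: o; exists d0 => //; last exact: (fconnect1 _ em).
  exact: connect_trans (fconnect1 _ ep) (fconnect1 _ em).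
have [d h1 <-] := red x; have [d' h2 <-] := red y => /old h3.
apply: connect_trans h1 (connect_trans h3 _).
by rewrite (fconnect_sym spur_fsucc_inj).
Qed.

Definition spur_diagram : disk_diagram.
Proof.
refine (@DiskDiagram (option (vert D)) (option (edge D)) (dface D) spur_src spur_fsucc
  spur_lface spur_fsucc_inj spur_vertP spur_faceP _ _ _ _ _).
- by move=> s; have [d hd] := dd_face_surj s; exists (spur_inj d); rewrite lfi.
- by move=> _; exists ep.
- set e := fun x y => _.
  have es : connect_sym e.
    apply: sym_connect_sym => x y; apply/existsP/existsP => -[d /andP[h1 h2]];
    by exists (opp_dart d); case: d h1 h2 => ? o; rewrite /opp_dart /= negbK => -> ->.
  have old u v : connect e (Some u) (Some v).
    have := dd_connected u v; apply: (@connect_map _ _ _ _ Some) => x y.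
    case/existsP=> -[g o] h; apply: connect1; apply/existsP; by exists (Some g, o).
  have new : connect e None (Some (src d0)).
    by apply: connect1; apply/existsP; exists em; rewrite /= !eqxx.
  case=> [u|] [v|] //.
  + by rewrite es; apply: connect_trans new (old _ _).
  + exact: connect_trans new (old _ _).
- by case=> [[e|] [] ] //=; [apply: (dd_noloop (e, true)) | apply: (dd_noloop (e, false))].
- by rewrite !card_option addSn dd_euler.
Defined.

Section Labels.
Variables (P : presentation) (lab : dart D -> letter (gens P)) (x : letter (gens P)).

Definition spur_lab (y : spur_dart) : letter (gens P) :=
  match y with (Some e, o) => lab (e, o) | (None, true) => x | (None, false) => linv x end.

Let labi d : spur_lab (spur_inj d) = lab d. Proof. by case: d. Qed.

Lemma spur_labelling : labelling lab -> @labelling P spur_diagram spur_lab.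
Proof.
move=> hl [[e|] o]; first exact: (hl (e, o)).
by case: o => //; exact/esym/linvK.
Qed.

Lemma read_spur_outer :
  @read_from P spur_diagram spur_lab ep = x :: linv x :: read_from lab d0.
Proof.
rewrite /read_from (@orbit_fcycle _ _ ep (em :: map spur_inj (orbit f d0))).
- by rewrite /= -map_comp; do 2 congr (_ :: _); apply: eq_map => d /=; apply: labi.
- rewrite /= inE map_inj_uniq // orbit_uniq andbT negb_or /=.
  by apply/andP; split; apply/mapP => -[].
- have -> : orbit f d0 = d0 :: traject f (f d0) m.-1 by rewrite /orbit -trajectS prednK.
  rewrite /= rcons_path /= !eqxx /= last_map last_traject; apply/andP; split; last first.
    by apply/eqP; exact: fs_a.
  apply: (@fpath_image _ _ f) => i hi.
  by apply: fs_o; apply/eqP => /it_inj; lia.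
Qed.

Lemma read_spur_old d s : lface d = Some s ->
  @read_from P spur_diagram spur_lab (spur_inj d) = read_from lab d.
Proof.
move=> hd; rewrite /read_from (@orbit_image _ _ f spur_fsucc spur_inj) //.
  by rewrite -map_comp; apply: eq_map => e /=; apply: labi.
move=> n; have hn : lface (iter n f d) = Some s by rewrite lface_iter.
by rewrite fs_o //; apply/eqP => h; move: hn; rewrite h lf.
Qed.

End Labels.
End AddSpur.

Definition point_diagram : disk_diagram.
Proof.
refine (@DiskDiagram unit void void (fun=> tt) id (fun=> None) _ _ _ _ _ _ _ _).
- by [].
- by case=> -[].
- by case=> -[].
- by case.
- by rewrite card_void.
- by case=> -[]; apply: connect0.
- by case=> -[].
- by rewrite card_unit !card_void.
Defined.

(** A single edge: the result of adding a spur to a point, which has no dart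
    to attach it to. *)
Definition segment_diagram : disk_diagram.
Proof.
refine (@DiskDiagram bool unit void (fun d => d.2) (@opp_dart unit) (fun=> None) _ _ _ _ _ _ _ _).
- by move=> [[] []] [[] []].
- move=> d d'; split; last by move/iter_findex => <-; elim: (findex _ _ _) => //= n ->; rewrite negbK.
  by case: d d' => [[] o] [[] o'] /= ->; apply: connect0.
- move=> d d'; split=> // _; have [->|hne] := eqVneq d d'; first exact: connect0.
  have -> : d' = opp_dart d by case: d d' hne => [[] []] [[] []].
  exact: fconnect1.
- by case.
- by move=> _; exists (tt, true).
- move=> u v; have [->|hne] := eqVneq u v; first exact: connect0.
  apply: connect1; apply/existsP; exists (tt, u); rewrite /= eqxx /=.
  by case: u v hne => [] [].
- by case=> -[] [].
- by rewrite card_bool card_void card_unit.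
Defined.

(** * From fillings to diagrams *)

Section Realize.
Local Open Scope nat_scope.
Variable P : presentation.
Implicit Types (x : letter (gens P)) (w u v : word (gens P)).

(** The potential [g] expresses that every closed edge path reads a trivial
    word.  It is carried along because it is what rules out loop edges when a
    chord is added. *)
Definition realized n w : Prop :=
  exists (D : disk_diagram) (lab : dart D -> letter (gens P)) (g : vert D -> word (gens P)),
    [/\ van_kampen lab w, area D = n &
        forall d : dart D, group_eq (g (src (opp_dart d))) (g (src d) ++ [:: lab d])].

Section Reading.
Variables (D : disk_diagram) (lab : dart D -> letter (gens P)).

Lemma read_fsucc (d : dart D) : read_from lab (fsucc d) = rot 1 (read_from lab d).
Proof.
rewrite /read_from -map_rot; congr map; have fi := @dd_fsucc_inj D.
rewrite /orbit; have -> : order (@fsucc D) (fsucc d) = order (@fsucc D) d.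
  by apply: eq_card => y; apply/esym; exact: (same_fconnect1 fi).
case: (order _ d) (order_gt0 (@fsucc D) d) (iter_order fi d) => // n _ h.
by rewrite trajectSr -iterSr h trajectS rot1_cons.
Qed.

Lemma read_rot (d : dart D) i : exists d', lface d' = lface d /\
  read_from lab d' = rot i (read_from lab d).
Proof.
elim: i => [|i [d' [h1 h2]]]; first by exists d; rewrite rot0.
have [hi|hi] := ltnP i (size (read_from lab d)).
  by exists (fsucc d'); split; [rewrite lface_fsucc | rewrite read_fsucc h2 -rotS].
by exists d; split=> //; rewrite rot_oversize // leqW.
Qed.

Lemma rel_word_same_face (d d' : dart D) : lface d = lface d' ->
  rel_word (read_from lab d) -> rel_word (read_from lab d').
Proof.
move/dd_faceP/iter_findex => <- h; elim: (findex _ _ _) => //= n IH.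
by rewrite read_fsucc; apply: rel_word_rot.
Qed.

Lemma potential_iter (g : vert D -> word (gens P)) :
  (forall d : dart D, group_eq (g (src (opp_dart d))) (g (src d) ++ [:: lab d])) ->
  forall k (d : dart D), group_eq (g (src (iter k (@fsucc D) d)))
     (g (src d) ++ map lab (traject (@fsucc D) d k)).
Proof.
move=> hg; elim=> [|k IH] d /=; first by rewrite cats0; apply: group_eq_refl.
rewrite -iterS iterSr; apply: group_eq_trans (IH _) _.
rewrite -cat1s catA; apply: group_eq_catr; rewrite src_fsucc; exact: hg.
Qed.

End Reading.

Lemma realized_nil : realized 0 [::].
Proof.
exists point_diagram, (fun d : dart point_diagram => match (d.1 : void) return letter (gens P) with end), (fun=> [::]); split.
- by split; [case=> -[] | case=> -[] | left; split=> //; exact: card_void].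
- exact: card_void.
- by case=> -[].
Qed.

Lemma realized_rot n k w : realized n w -> realized n (rot k w).
Proof.
case=> D [lab [g [[h1 h2 h3] h4 h5]]]; exists D, lab, g; split=> //; split=> //.
case: h3 => [[e ->]|[d [h ->]]]; first by left; rewrite /rot /=; case: k.
by right; have [d' [k1 k2]] := read_rot lab d k; exists d'; rewrite k1 k2.
Qed.

Lemma realized_spur n x w : realized n w -> realized n (x :: linv x :: w).
Proof.
case=> D [lab [g [[h1 h2 h3] h4 h5]]].
case: h3 => [[hE hw]|[d0 [h0 hw]]].
  have hn : n = 0.
    rewrite -h4; apply/eqP; rewrite eqn0Ngt; apply/negP => /card_gt0P[s _].
    have [d _] := dd_face_surj s; have : 0 < #|edge D| by apply/card_gt0P; exists d.1.
    by rewrite hE.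
  pose lb (d : dart segment_diagram) := if d.2 then x else linv x.
  exists segment_diagram, lb, (fun z : bool => if z then [::] else [:: x]); split.
  - split; first by case=> -[] [] //=; rewrite /lb /= linvK.
      by case=> -[] [].
    right; exists (tt, true); split=> //; rewrite hw /read_from.
    by rewrite (@orbit_fcycle _ _ (tt, true) [:: (tt, false)]).
  - by rewrite hn; exact: card_void.
  - case=> -[] [] /=; first exact: group_eq_refl.
    by apply: group_eq_sym; exact: (group_eq_free [::] x [::]).
exists (spur_diagram h0), (spur_lab lab x),
  (fun z => if z is Some z' then g z' else g (src d0) ++ [:: x]); split=> //.
  split; first exact: spur_labelling.
    case=> [[e|] o] // hl; have [s hs] : exists s, lface (e, o) = Some s.
      by case E: (lface (e, o)) hl => [s|] //= hl; [exists s | move: hl; rewrite /= E].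
    have := h2 (e, o); rewrite hs => /(_ isT).
    by rewrite -(read_spur_old h0 lab x hs).
  by right; exists (None, true); split=> //; rewrite read_spur_outer hw.
case=> [[e|] o]; first exact: (h5 (e, o)).
case: o => /=; first exact: group_eq_refl.
by apply: group_eq_sym; rewrite -catA /=; have := group_eq_free (g (src d0)) x [::]; rewrite !cats0.
Qed.

Hypothesis no_trivial : forall x, ~ group_eq [:: x] [::].

(** If the two ends of the chord coincided, the covered arc would be a closed
    path, so its word, which equals the letter [x] in the group, would be
    trivial. *)
Lemma realized_chord n x u v : realized n (u ++ v) -> rel_word (linv x :: u) ->
  realized n.+1 (x :: v).
Proof.
case=> D [lab [g [[h1 h2 h3] h4 h5]]] hr; have := size_rel_word hr => /= hu.
case: h3 => [[hE hw]|[d0 [h0 hw]]]; first by case: u hu hw {hr}.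
pose k := size u; pose m := order (@fsucc D) d0.
have hsz : k <= m.
  by rewrite /m -(size_orbit (@fsucc D)) -(size_map lab) -/(read_from lab d0) -hw size_cat leq_addr.
have [hu1 hv1] : u = map lab (traject (@fsucc D) d0 k) /\
    v = map lab (traject (@fsucc D) (iter k (@fsucc D) d0) (m - k)).
  move: hw; rewrite /read_from /orbit -/m -{1}(subnKC hsz) trajectD map_cat => hw.
  have := congr1 (take k) hw; have := congr1 (drop k) hw.
  by rewrite !take_size_cat ?drop_size_cat ?size_map ?size_traject.
have hne : src d0 != src (iter k (@fsucc D) d0).
  apply/eqP => he; have := potential_iter h5 k d0; rewrite -he -hu1 => hcan.
  have hu0 := group_eq_cancel (group_eq_sym hcan).
  apply: (no_trivial (x := x)); apply: group_eq_trans hu0.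
  exact/group_eq_sym/chord_letter.
have hk : 0 < k < m.
  apply/andP; split; first exact: hu.
  rewrite ltn_neqAle hsz andbT; apply/eqP => hkm.
  by move: hne; rewrite hkm iter_order ?eqxx //; apply: dd_fsucc_inj.
pose CD := chord_diagram h0 hk hne.
exists CD, (chord_lab lab x), g; split.
- split; first exact: chord_labelling.
    have hnew : rel_word (@read_from P CD (chord_lab lab x) (None, false)).
      by rewrite read_chord_face -hu1.
    move=> y hy; case E: (lface y) hy => [[s|]|] // _; last first.
      by apply: rel_word_same_face hnew; rewrite E.
    case: y E => [[e|] o]; last by case: o.
    rewrite /=; case: ifP => // _; case E: (lface (e, o)) => [s'|] //= _.
    have := h2 (e, o); rewrite E => /(_ isT).
    by rewrite -(read_chord_old h0 hk hne lab x E).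
  by right; exists (None, true); split=> //; rewrite read_chord_outer hv1.
- by rewrite /area /= card_option -h4.
- case=> [[e|] o]; first exact: (h5 (e, o)).
  have hg := potential_iter h5 k d0; rewrite -hu1 in hg.
  have hux := chord_letter hr.
  case: o => /=.
    exact: group_eq_trans hg (group_eq_catl _ hux).
  apply: group_eq_sym; apply: group_eq_trans (group_eq_catr _ hg) _.
  apply: group_eq_trans (group_eq_catr _ (group_eq_catl _ hux)) _.
  by rewrite -catA /=; have := group_eq_free (g (src d0)) x [::]; rewrite !cats0.
Qed.

Lemma fill_realized n w : fill n w -> realized n w.
Proof.
elim=> {n w} [|n k w _ IH|n x w _ IH|n x u v _ IH hr].
- exact: realized_nil.
- exact: realized_rot.
- exact: realized_spur.
- exact: realized_chord IH hr.
Qed.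

End Realize.

(** * Cyclic reduction and the Dehn function *)

Section CyclicReduction.
Local Open Scope nat_scope.
Variable P : presentation.
Implicit Types (x : letter (gens P)) (w u v : word (gens P)).

(** Applied to the cyclic word, it locates a cancelling pair. *)
Lemma path_failure (T : Type) (e : rel T) y (p : seq T) : ~~ path e y p ->
  exists p1 (a b : T) p2, y :: p = p1 ++ a :: b :: p2 /\ ~~ e a b.
Proof.
elim: p y => //= z p IH y; rewrite negb_and => /orP[h|/IH[p1 [u [v [p2 [h1 h2]]]]]].
  by exists [::], y, z, p.
by exists (y :: p1), u, v, p2; rewrite h1.
Qed.

Lemma unreduced_rot w : ~~ cyc_reduced w ->
  exists i x v, rot i w = x :: linv x :: v.
Proof.
case: w => // y p; rewrite /cyc_reduced /= => h0.
have [p1 [u [v [p2 [h]]]]] := path_failure h0; clear h0.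
rewrite negbK => /eqP hv; rewrite hv in h.
case/lastP: p2 h => [|p2 z].
  case: p1 => [|y' p1] /=.
    case: p => [|? [|? ?]] //= -[-> /esym]; case: u {hv} => g o; rewrite /linv /= => -[].
    by case: o.
  case=> _ h.
  have {h} : rcons p y = rcons (rcons p1 u) (linv u) by rewrite h -!cats1 -catA.
  case/rcons_inj => -> hy; exists (size (y :: p1)), u, p1.
  by rewrite -rcons_cons -cats1 rot_size_cat hy.
rewrite -!rcons_cons -rcons_cat => /rcons_inj[-> _].
exists (size p1), u, (p2 ++ p1).
by rewrite rot_size_cat.
Qed.

(** Undoing a reduction inserts an inverse pair, which costs no area. *)
Lemma cyclic_reduction w : exists w', [/\ cyc_reduced w', size w' <= size w,
  (forall n, fill n w' -> fill n w) & (group_eq w [::] -> group_eq w' [::])].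
Proof.
have [n] := ubnP (size w); elim: n w => // n IH w hn.
have [h|/unreduced_rot[i [x [v h]]]] := boolP (cyc_reduced w); first by exists w.
have hsz : size w = (size v).+2 by rewrite -(size_rot i) h.
have [|w' [h1 h2 h3 h4]] := IH v; first by move: hn; rewrite hsz; lia.
exists w'; split=> //; first by rewrite hsz; lia.
- by move=> k /h3 hk; apply: (@fill_unrot _ _ i); rewrite h; apply: fill_spur.
- move/(group_eq_rot i); rewrite h => hg; apply: h4; apply: group_eq_trans hg.
  exact/group_eq_sym/(group_eq_free [::]).
Qed.

End CyclicReduction.

Section DehnFacts.
Variables (R : realType) (P : presentation).
Implicit Types (x : letter (gens P)) (w u v : word (gens P)).

(** Its boundary walk would be a loop edge. *)
Lemma no_diagram_letter x (D : disk_diagram) (lab : dart D -> letter (gens P)) :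
  ~ van_kampen lab [:: x].
Proof.
case=> _ _ [[_ //]|[d [_ /(congr1 size)]]].
rewrite size_map size_orbit /= => /esym ho.
have := iter_order (@dd_fsucc_inj D) d; rewrite ho /= => h.
by have := fsucc_neq d; rewrite h eqxx.
Qed.

Lemma area_min_letter x : area_min R [:: x] = +oo%E.
Proof.
rewrite /area_min; set A := (X in ereal_inf X).
have -> : A = classical_sets.set0; last by rewrite ereal_inf0.
by rewrite -classical_sets.subset0 => a [D [lab [/no_diagram_letter]]].
Qed.

Lemma dehn_ge n w : group_eq w [::] -> (size w <= n)%N -> cyc_reduced w ->
  (area_min R w <= dehn R P n)%E.
Proof. by move=> h1 h2 h3; apply: ereal_sup_ubound; exists w. Qed.

(** A one-letter word is cyclically reduced but bounds no diagram without loop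
    edges, so a trivial generator makes the Dehn function infinite from 1 on. *)
Lemma dehn_no_trivial n (B : R) : (0 < n)%N -> (dehn R P n <= B%:E)%E ->
  forall x, ~ group_eq [:: x] [::].
Proof.
move=> hn hB x hx; have hr : cyc_reduced [:: x].
  by rewrite /cyc_reduced /= andbT; apply/eqP; case: x {hx} => g [] [].
have := le_trans (dehn_ge hx hn hr) hB; rewrite area_min_letter.
by rewrite leye_eq.
Qed.

(** A finite infimum over natural numbers is attained. *)
Lemma area_min_attained w (B : R) : (area_min R w <= B%:E)%E ->
  exists (D : disk_diagram) (lab : dart D -> letter (gens P)),
    van_kampen lab w /\ (area D)%:R <= B.
Proof.
move=> hB; pose Q n := `[< exists (D : disk_diagram) (lab : dart D -> letter (gens P)),
    van_kampen lab w /\ area D = n >].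
have hQ : exists n, Q n.
  apply/not_existsP => hno.
  have : area_min R w = +oo%E.
    rewrite /area_min; set A := (X in ereal_inf X).
    have -> : A = classical_sets.set0; last by rewrite ereal_inf0.
    rewrite -classical_sets.subset0 => a [D [lab [h _]]]; apply: (hno (area D)).
    by apply/asboolP; exists D, lab.
  by move=> h; move: hB; rewrite h leye_eq.
case: (ex_minnP hQ) => n /asboolP[D [lab [h1 h2]]] hmin; exists D, lab; split=> //.
rewrite -lee_fin; apply: le_trans hB; apply: le_ereal_inf_tmp => a [D' [lab' [h3 ->]]].
by rewrite lee_fin ler_nat h2; apply: hmin; apply/asboolP; exists D', lab'.
Qed.

(** The Dehn function only sees cyclically reduced words; cyclic reduction
    transports its bound to all trivial words. *)
Lemma dehn_fill n w (B : R) : group_eq w [::] -> (size w <= n)%N ->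
  (dehn R P n <= B%:E)%E -> exists2 k, fill k w & k%:R <= B.
Proof.
move=> hw hn hB; have [w' [h1 h2 h3 h4]] := cyclic_reduction w.
have := le_trans (dehn_ge (h4 hw) (leq_trans h2 hn) h1) hB.
case/area_min_attained => D [lab [[g1 g2 g3] g4]].
by exists (area D) => //; apply/h3/(diagram_fill g1 g2 g3).
Qed.

Lemma minimal_area_le (D : disk_diagram) w k :
  (forall x, ~ group_eq [:: x] [::]) ->
  ((area D)%:R)%:E = area_min R w -> fill k w -> (area D <= k)%N.
Proof.
move=> hx hm /(fill_realized hx)[D' [lab' [_ [h1 h2 _]]]].
rewrite -(ler_nat R) -lee_fin hm; apply: ereal_inf_lbound.
by exists D', lab'; rewrite h2.
Qed.

End DehnFacts.

(** * Bridges *)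

Section Bridge.
Local Open Scope nat_scope.
Variables (D : disk_diagram) (S : subcx D) (d : dart D).
Hypotheses (hS : subcx_disk S) (hb1 : bdart S d) (hb2 : bdart S (opp_dart d)).

Let S' : subcx D := Subcx (sverts S) (sedges S :\ d.1) (sfaces S).

(** A 2-cell is assigned to a side by any of its corners: since both sides of
    the bridge [d] are outside, its boundary walk avoids the bridge. *)
Definition bridge_side (z : vert D) : subcx D := Subcx
  [set v in sverts S | connect (adj S') z v]
  [set e in sedges S' | connect (adj S') z (src (e, true))]
  [set s in sfaces S | [exists d', (lface d' == Some s) && connect (adj S') z (src d')]].

Let csym : connect_sym (adj S'). Proof. exact: adj_connect_sym. Qed.

Let dE : d.1 \in sedges S. Proof. by case/andP: hb1. Qed.

Let closed' : subcx_closed S'.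
Proof.
case: hS => -[h1 h2] _ _; split=> [d'|d' s hd hs] /=; rewrite in_setD1.
  by case/andP => _; apply: h1.
rewrite (h2 _ _ hd hs) andbT; apply/eqP => /dart_same_edge[] hh; [move: hb1|move: hb2];
by rewrite bdart_facing -hh /facing hd hs andbF.
Qed.

Let step z d' : d'.1 \in sedges S' -> connect (adj S') z (src d') = connect (adj S') z (src (opp_dart d')).
Proof.
move=> h; have h1 := connect1 (adj_dart h).
apply/idP/idP => h2; apply: connect_trans h2 _ => //; by rewrite csym.
Qed.

Let in_side_edge z d' : (d'.1 \in sedges (bridge_side z)) =
  (d'.1 \in sedges S') && connect (adj S') z (src d').
Proof.
rewrite inE; have [h|//] := boolP (d'.1 \in sedges S').
by case: d' h => e [] h //=; rewrite (step z h).
Qed.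

Let face_conn z s d1 d2 : s \in sfaces S -> lface d1 = Some s -> lface d2 = Some s ->
  connect (adj S') z (src d1) = connect (adj S') z (src d2).
Proof.
move=> hs h1; rewrite -h1 => /esym/dd_faceP/iter_findex <-; elim: (findex _ _ _) => //= n IH.
have hn : lface (iter n (@fsucc D) d1) = Some s by rewrite lface_iter.
by rewrite IH src_fsucc; apply: step; case: closed' => _ h; apply: h hn hs.
Qed.

Let in_side_face z s d' : lface d' = Some s ->
  (s \in sfaces (bridge_side z)) = (s \in sfaces S) && connect (adj S') z (src d').
Proof.
move=> h; rewrite inE; have [hs|//] := boolP (s \in sfaces S).
apply/existsP/idP => [[d2 /andP[/eqP h2 h3]]|h3]; last by exists d'; rewrite h eqxx.
by rewrite (face_conn _ hs h h2).
Qed.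

Let side_closed z : subcx_closed (bridge_side z).
Proof.
have [c1 c2] := closed'; split=> [d'|d' s hd].
  by rewrite in_side_edge => /andP[h k]; rewrite inE k (c1 _ h).
by rewrite (in_side_face z hd) in_side_edge => /andP[h ->]; rewrite (c2 _ _ hd h).
Qed.

Let side_connected z : subcx_connected (bridge_side z).
Proof.
have key u v : connect (adj S') z u -> connect (adj S') u v -> connect (adj (bridge_side z)) u v.
  move=> hz /connectP[p]; elim: p u hz => [|y p IH] u hz /=; first by move=> _ ->.
  case/andP => /existsP[d' /and3P[h1 /eqP h2 /eqP h3]] h4 h5.
  apply: (@connect_trans _ _ y).
    apply: connect1; rewrite -h2 -h3; apply: adj_dart.
    by rewrite in_side_edge h1 h2 hz.
  apply: (IH y _ h4 h5); apply: connect_trans hz (connect1 _).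
  by rewrite -h2 -h3; apply: adj_dart.
move=> u v; rewrite !inE => /andP[_ hu] /andP[_ hv]; apply: (key _ _ hu).
by apply: connect_trans hv; rewrite csym.
Qed.

Let x := src d.
Let y := src (opp_dart d).

Let xS : x \in sverts S. Proof. by case: hS => -[h _] _ _; apply: h. Qed.
Let yS : y \in sverts S. Proof. by case: hS => -[h _] _ _; apply: h. Qed.

Let cover v : v \in sverts S -> connect (adj S') x v || connect (adj S') y v.
Proof.
have key p u : path (adj S) u p -> connect (adj S') x u || connect (adj S') y u ->
    connect (adj S') x (last u p) || connect (adj S') y (last u p).
  elim: p u => //= w p IH u /andP[/existsP[d' /and3P[h1 /eqP h2 /eqP h3]] hp] hu.
  apply: IH hp _; have [he|hne] := eqVneq d'.1 d.1.
    by case: (dart_same_edge he) h3 => -> <-; rewrite ?opp_dartK connect0 ?orbT.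
  have hd' : d'.1 \in sedges S' by rewrite /= in_setD1 hne.
  by rewrite -h3 -!(step _ hd') h2.
move=> hv; case: hS => _ hco _; have /connectP[p hp ->] := hco x v xS hv.
by apply: key hp _; rewrite connect0.
Qed.

Let cardS' : #|sedges S| = #|sedges S'|.+1.
Proof. by rewrite (cardsD1 d.1 (sedges S)) dE. Qed.

Let separated : connect (adj S') x y = false.
Proof.
apply/negP => hxy; have hco : subcx_connected S'.
  have key v : v \in sverts S -> connect (adj S') x v.
    by move=> /cover/orP[//|h]; apply: connect_trans hxy h.
  move=> u v hu hv; apply: (@connect_trans _ _ x); last exact: key.
  by rewrite csym; apply: key.
have := euler_le closed' hco; case: hS => _ _; rewrite cardS' /=; lia.
Qed.

Let disjoint v : connect (adj S') x v -> connect (adj S') y v = false.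
Proof.
move=> h; apply/negP => h2; have := separated.
by rewrite (connect_trans h) // csym.
Qed.

Let split_card (T : finType) (A B1 B2 : {set T}) : (forall t, (t \in A) = (t \in B1) || (t \in B2)) ->
  (forall t, t \in B1 -> t \notin B2) -> #|A| = #|B1| + #|B2|.
Proof.
move=> h1 h2; rewrite -cardsUI; have -> : B1 :&: B2 = set0.
  by apply/setP => t; rewrite !inE; apply/andP => -[/h2/negP].
by rewrite cards0 addn0; apply: eq_card => t; rewrite inE h1.
Qed.

Lemma bridge_faces_cover s : (s \in sfaces S) = (s \in sfaces (bridge_side x)) || (s \in sfaces (bridge_side y)).
Proof.
have [d' hd'] := dd_face_surj s; rewrite !(in_side_face _ hd') -andb_orr.
have [hs|//] := boolP (s \in sfaces S); rewrite cover //.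
by case: hS => -[h1 h2] _ _; apply: h1; apply: h2 hd' hs.
Qed.

Lemma bridge_faces_disj s : s \in sfaces (bridge_side x) -> s \notin sfaces (bridge_side y).
Proof.
have [d' hd'] := dd_face_surj s; rewrite !(in_side_face _ hd') => /andP[-> /disjoint ->].
by [].
Qed.

(** The two sides add up to Euler characteristic 2 and each contributes at
    most 1. *)
Lemma bridge_euler z : z = x \/ z = y ->
  #|sverts (bridge_side z)| + #|sfaces (bridge_side z)| = #|sedges (bridge_side z)| + 1.
Proof.
have ex := euler_le (side_closed x) (side_connected (z := x)).
have ey := euler_le (side_closed y) (side_connected (z := y)).
have vs : #|sverts S| = #|sverts (bridge_side x)| + #|sverts (bridge_side y)|.
  apply: split_card => v; rewrite !inE; last by move=> /andP[-> /disjoint ->].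
  by rewrite -andb_orr; case: (boolP (v \in _)) => //= /cover ->.
have fs : #|sfaces S| = #|sfaces (bridge_side x)| + #|sfaces (bridge_side y)|.
  by apply: split_card => s; [exact: bridge_faces_cover | exact: bridge_faces_disj].
have es : #|sedges S'| = #|sedges (bridge_side x)| + #|sedges (bridge_side y)|.
  apply: split_card => e; rewrite -[e]/((e, true).1) !in_side_edge.
    rewrite -andb_orr; case: (boolP (_ \in _)) => //= h; rewrite cover //.
    by case: closed' => h1 _; apply: (h1 (e, true)).
  by case/andP=> -> /disjoint ->.
case: hS => _ _; rewrite cardS' vs fs es => h [] ->; lia.
Qed.

(** Two 2-cells sharing an edge lie on the same side of the bridge. *)
Lemma bridge_faces_split d' s1 s2 : lface d' = Some s1 -> lface (opp_dart d') = Some s2 ->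
  s1 \in sfaces (bridge_side x) -> s2 \in sfaces (bridge_side y) -> False.
Proof.
move=> h1 h2; rewrite (in_side_face _ h1) (in_side_face _ h2) => /andP[hs1 k1] /andP[hs2].
have he : d'.1 \in sedges S' by case: closed' => _ h; apply: h h1 hs1.
by rewrite -(step _ he) (disjoint k1).
Qed.

(** A side without 2-cells is a tree, hence has a leaf away from the foot of
    the bridge, or is reduced to that foot, which is then itself a leaf. *)
Lemma bridge_faceless_leaf : sfaces (bridge_side y) = set0 -> exists e, free_leaf S e.
Proof.
move=> hF; have he := bridge_euler (or_intror erefl); rewrite hF cards0 addn0 in he.
have yin : y \in sverts (bridge_side y) by rewrite inE yS connect0.
have hyx : y != x by rewrite eq_sym; apply: dd_noloop.
have no_face d' : d'.1 \in sedges S -> connect (adj S') y (src d') -> bdart S d'.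
  move=> h1 h2; rewrite bdart_facing h1 /= /facing; case E: (lface d') => [s|] //.
  apply/negP => hs; have : s \in sfaces (bridge_side y) by rewrite (in_side_face _ E) hs.
  by rewrite hF inE.
have [hV|hV] := leqP #|sverts (bridge_side y)| 1.
  have hVy : sverts (bridge_side y) = [set y].
    by apply/esym/eqP; rewrite eqEcard sub1set yin cards1.
  exists (opp_dart d); split; rewrite ?opp_dartK // => d' h1 h2.
  have [/dart_same_edge[h|//]|hne] := eqVneq d'.1 d.1.
    by move: hyx; rewrite /y -h2 h eqxx.
  have h1' : d'.1 \in sedges S' by rewrite /= in_setD1 hne.
  have : src (opp_dart d') \in sverts (bridge_side y).
    rewrite inE -(step _ h1') h2 connect0 andbT.
    by case: closed' => h _; apply: (h (opp_dart d')).
  rewrite hVy inE => /eqP h; have := dd_noloop d'.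
  by rewrite h h2 eqxx.
have hlt : #|sedges (bridge_side y)| < #|sverts (bridge_side y)| by rewrite he addn1.
have [d' [h1 h2 h3]] := leaf_exists (side_closed y) (side_connected (z := y)) hlt yin hV.
move: (h1); rewrite in_side_edge => /andP[k1 k2].
have k3 : d'.1 \in sedges S by move: k1; rewrite /= in_setD1 => /andP[].
exists d'; split.
- exact: no_face.
- by apply: no_face; rewrite // -(step _ k1).
- move=> d2 g1 g2; apply: h3 => //; rewrite in_side_edge g2 k2 andbT /= in_setD1 g1 andbT.
  apply/eqP => /dart_same_edge[] hh.
    have : connect (adj S') y x by rewrite /x -hh g2.
    by rewrite csym separated.
  by move: h2; rewrite -g2 hh eqxx.
Qed.

End Bridge.

(** * Extremal regions *)

Section Region.
Local Open Scope nat_scope.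
Variable D : disk_diagram.
Implicit Types (A B : {set dface D}) (S : subcx D) (d : dart D).

Lemma bridge_side_opp S d z : bridge_side S (opp_dart d) z = bridge_side S d z.
Proof. by []. Qed.

(** Connectedness of [A] through common edges, in a form without paths. *)
Definition dual_connected A : Prop := forall B, B \proper A -> B != set0 ->
  exists d, facing B d && facing (A :\: B) (opp_dart d).

(** A bridge separates the 2-cells into two families sharing no edge; by
    connectedness one is empty, and that side contains a leaf. *)
Lemma no_bridge S d : subcx_disk S -> dual_connected (sfaces S) ->
  (forall e, ~ free_leaf S e) -> bdart S d -> bdart S (opp_dart d) -> False.
Proof.
move=> hS hdc hl b1 b2.
have b3 : bdart S (opp_dart (opp_dart d)) by rewrite opp_dartK.
have [h|hy] := eqVneq (sfaces (bridge_side S d (src (opp_dart d)))) set0.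
  by have [e /hl] := bridge_faceless_leaf hS b1 b2 h.
have [h|hx] := eqVneq (sfaces (bridge_side S d (src d))) set0.
  rewrite -bridge_side_opp -{2}[d]opp_dartK in h.
  by have [e /hl] := bridge_faceless_leaf hS b2 b3 h.
have cov := bridge_faces_cover hS b1 b2; have dis := bridge_faces_disj hS b1 b2.
have hpr : sfaces (bridge_side S d (src d)) \proper sfaces S.
  apply/properP; split; first by apply/subsetP => s hs; rewrite cov hs.
  have /set0Pn[s hs] := hy; exists s; first by rewrite cov hs orbT.
  by apply/negP => /dis; rewrite hs.
have [d1] := hdc _ hpr hx; rewrite /facing.
case E1: (lface d1) => [s1|] //; case E2: (lface (opp_dart d1)) => [s2|]; last by rewrite andbF.
case/andP => h1; rewrite in_setD cov => /andP[h2]; rewrite (negbTE h2) /=.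
exact: (bridge_faces_split hS b1 b2 E1 E2 h1).
Qed.

(** If a collapse gets stuck before reaching [A], the remaining set of 2-cells
    contains [A] strictly but has no frontier edge outside that of [A]; the
    hypothesis on supersets, which says that [A] has no holes, forbids it. *)
Lemma peel_to_region S n A : subcx_disk S -> A \subset sfaces S ->
  peel (full_subcx D) S n ->
  (forall B, A \proper B -> #|frontier A| < #|frontier B|) ->
  exists T k, [/\ peel (full_subcx D) T k, sfaces T = A & forall e, ~ free_leaf T e].
Proof.
move=> hS hA hP hout; have [m] := ubnP #|sedges S|.
elim: m S n hS hA hP => // m IH S n hS hA hP hm; have [h1 h2 h3] := hS.
have [hAS|hAS] := eqVneq A (sfaces S); last first.
  have hpr : A \proper sfaces S by rewrite properEneq hAS.
  have /subsetPn[d d1 d2] : ~~ (frontier (sfaces S) \subset frontier A).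
    by apply/negP => /subset_leq_card; rewrite leqNgt hout.
  move: (d1); rewrite inE {1}/facing; case E: (lface d) => [s|] // /andP[hs hso].
  have hfs := free_side_exists h1 d1 E.
  have sA : s \notin A.
    apply: contra d2 => hsA; rewrite inE {1}/facing E hsA /=.
    apply: contra hso; rewrite /facing; case: (lface (opp_dart d)) => // t.
    exact: (subsetP hA).
  have hP' := peel_face hP hfs; have [hS' _] := peel_disk (full_disk D) hP'.
  apply: (IH _ _ hS' _ hP'); first by rewrite subsetD1 hA sA.
  by have [g3 _] := card_del_face h1 hfs; move: hm; rewrite g3; lia.
have [[e he]|hno] := pselect (exists e, free_leaf S e); last first.
  by exists S, n; split=> // e he; apply: hno; exists e.
have hP' := peel_leaf hP he; have [hS' _] := peel_disk (full_disk D) hP'.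
apply: (IH _ _ hS' _ hP') => //.
by have [g3 _] := card_del_leaf h1 he; move: hm; rewrite g3; lia.
Qed.

(** Without bridges or leaves every edge has at most one outward side, so the
    perimeter only counts frontier edges. *)
Lemma region_perimeter A :
  (forall B, A \proper B -> #|frontier A| < #|frontier B|) -> dual_connected A ->
  exists T k, [/\ peel (full_subcx D) T k, sfaces T = A & perimeter T = #|frontier A|].
Proof.
move=> hout hdc.
have [|T [k [hP hF hl]]] := peel_to_region (full_disk D) _ (peel_start _) hout.
  exact: subsetT.
exists T, k; split=> //; have [hT _] := peel_disk (full_disk D) hP; have [[c1 c2] _ _] := hT.
rewrite -hF in hdc; have hb := no_bridge hT hdc hl.
rewrite /perimeter -(card_imset _ (can_inj (@opp_dartK D))); apply: eq_card => d.
apply/imsetP/idP => [[d' hd' ->]|].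
  rewrite inE in hd'; rewrite inE opp_dartK -hF.
  have : ~~ bdart T (opp_dart d') by apply/negP; apply: hb hd'.
  by case/andP: (hd') => h _; move: hd'; rewrite !bdart_facing h /= negbK => -> ->.
rewrite inE -hF => /andP[h1 h2]; exists (opp_dart d); rewrite ?opp_dartK // inE bdart_facing h2 andbT.
by move: h1; rewrite /facing; case E: (lface d) => [s|] //; apply: (c2 d s E).
Qed.

Lemma frontier_split A B : B \subset A ->
  (forall d, ~~ (facing B d && facing (A :\: B) (opp_dart d))) ->
  #|frontier A| = #|frontier B| + #|frontier (A :\: B)|.
Proof.
move=> hBA hno; have fU d : facing A d = facing B d || facing (A :\: B) d.
  rewrite /facing; case: (lface d) => // s; rewrite in_setD.
  by case: (boolP (s \in B)) => //= /(subsetP hBA).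
have fI d : facing B d -> facing (A :\: B) d = false.
  by rewrite /facing; case: (lface d) => // s; rewrite in_setD => ->.
rewrite -cardsUI; have -> : frontier B :&: frontier (A :\: B) = set0.
  by apply/setP => d; rewrite !inE; apply/andP => -[/andP[/fI -> _] /andP[]].
rewrite cards0 addn0; apply: eq_card => d; rewrite !inE !fU.
move: (fI d) (fI (opp_dart d)) (hno d) (hno (opp_dart d)); rewrite opp_dartK.
case: (facing B d); case: (facing B (opp_dart d)); case: (facing (A :\: B) d);
  case: (facing (A :\: B) (opp_dart d)) => //= h1 h2 _ _;
  by [have := h1 isT | have := h2 isT].
Qed.

(** Among the violations of the linear inequality take one with the smallest
    frontier, and then with the most 2-cells.  Filling a hole or passing to
    one of two families sharing no edge would improve it. *)
Lemma extremal_region (R : realType) (H : R) A0 : (0 <= H)%R ->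
  (H * (#|frontier A0|)%:R < (#|A0|)%:R)%R ->
  exists A, [/\ (H * (#|frontier A|)%:R < (#|A|)%:R)%R,
    forall B, A \proper B -> #|frontier A| < #|frontier B| & dual_connected A].
Proof.
move=> H0 hA0; pose M := #|dface D|.
(* Lexicographic order: frontier first, then decreasing number of 2-cells. *)
pose wt A := #|frontier A| * M.+1 + (M - #|A|).
pose bad A := (H * (#|frontier A|)%:R < (#|A|)%:R)%R.
have cM A : #|A| <= M by apply: max_card.
case: (arg_minnP wt (hA0 : bad A0)) => A hA hmin; exists A; split=> //.
  move=> B hB; rewrite ltnNge; apply/negP => hle.
  have hc := proper_card hB.
  have hbB : bad B.
    apply: (@le_lt_trans _ _ (H * (#|frontier A|)%:R)%R); first by rewrite ler_wpM2l // ler_nat.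
    by apply: lt_trans hA _; rewrite ltr_nat.
  have := hmin B hbB; rewrite /wt; have := cM B; nia.
move=> B hB hB0; apply/existsP; apply: contraT => /existsPn hno; exfalso.
have hBA := proper_sub hB; have hf := frontier_split hBA hno.
have hc : #|A| = #|B| + #|A :\: B| by rewrite -(cardsID B A) (setIidPr hBA).
have f1 : 0 < #|frontier B|.
  by rewrite lt0n cards_eq0; apply: contra hB0 => /eqP/frontier_eq0 ->.
have f2 : 0 < #|frontier (A :\: B)|.
  rewrite lt0n cards_eq0; apply/eqP => /frontier_eq0 /eqP; rewrite setD_eq0 => h.
  by move: hB; rewrite properE h andbF.
have small C : #|frontier C| < #|frontier A| -> ~~ bad C.
  move=> hC; apply/negP => /hmin; rewrite /wt; have := cM A; have := cM C; nia.
have := small B; have := small (A :\: B); rewrite hf /bad -!leNgt.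
move=> /(_ ltac:(lia)) g1 /(_ ltac:(lia)) g2.
by move: hA; rewrite /bad hf hc !natrD mulrDr ltNge lerD.
Qed.

End Region.

(** * Linear isoperimetric inequality in minimal diagrams *)

Section Isoperimetry.
Variables (R : realType) (P : presentation) (D : disk_diagram).
Hypothesis hmin : area_minimising R P D.

(** A positive perimeter excludes the one-vertex diagram, so the boundary word
    is read along a walk. *)
Lemma boundary_word (lab : dart D -> letter (gens P)) w :
  (0 < perimeter (full_subcx D))%N -> boundary_reads lab w ->
  exists2 p, bd_walk (full_subcx D) p & w = map lab p.
Proof.
move=> hp [[hE _]|[d [hd ->]]]; last by exists (orbit (@fsucc D) d) => //; apply: bd_walk_full.
case/card_gt0P: hp => d _; have : (0 < #|edge D|)%N by apply/card_gt0P; exists d.1.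
by rewrite hE.
Qed.

(** The boundary word of a minimal diagram has a filling by at most [B]
    relators, and realising it cannot give a smaller area. *)
Lemma minimal_area_le_dehn (n : nat) (B : R) : (0 < perimeter (full_subcx D) <= n)%N ->
  (dehn R P n <= B%:E)%E -> (area D)%:R <= B.
Proof.
case/andP => hp hn hB; have [lab [w [[h1 h2 h3] h4]]] := hmin.
have [p hpw hw] := boundary_word hp h3.
have hf := diagram_fill h1 h2 h3.
have hs : (size w <= n)%N by rewrite hw size_map (size_bd_walk hpw).
have [k hk hkB] := dehn_fill (fill_trivial hf) hs hB.
have nt := dehn_no_trivial (leq_trans hp hn) hB.
by apply: le_trans hkB; rewrite ler_nat; apply: minimal_area_le nt h4 hk.
Qed.

Variables (K alpha : R).
Hypotheses (K0 : 0 <= K) (alpha1 : 1 <= alpha) (hdehn : dehn_bound P K alpha).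

Lemma powR_split (x : R) : 0 < x -> x `^ alpha = x `^ (alpha - 1) * x.
Proof.
move=> x0; have hx : x != 0 by rewrite gt_eqF.
rewrite -[X in _ = _ * X](powRr1 (ltW x0)) -powRD ?hx ?implybT //.
by rewrite subrK.
Qed.

(** For an extremal violation [A] with frontier of length [p], replacing the
    part of the diagram over [A] by an optimal filling of its boundary word
    cannot decrease the area, so [#|A| <= K * p `^ alpha]; this is used when
    [p <= n].  When [p > n] the total area already suffices. *)
Lemma linear_isoperimetry (n : nat) (A : {set dface D}) :
  (0 < perimeter (full_subcx D) <= n)%N ->
  (#|A|)%:R <= K * n%:R `^ (alpha - 1) * (#|frontier A|)%:R.
Proof.
move=> hpn; case/andP: (hpn) => hp hn; have n0 := leq_trans hp hn.
set H := K * _; have H0 : 0 <= H by rewrite mulr_ge0 // powR_ge0.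
rewrite leNgt; apply/negP => /(extremal_region H0)[{}A [hA hout hdc]].
have [T [k [hP hF hpT]]] := region_perimeter hout hdc.
have [hT hcard] := peel_disk (full_disk D) hP.
have A0 : (0 < #|A|)%N by rewrite -(ltr_nat R); apply: le_lt_trans hA; rewrite mulr_ge0.
have p0 : (0 < #|frontier A|)%N.
  by rewrite lt0n cards_eq0; apply/eqP => /frontier_eq0 h; rewrite h cards0 in A0.
have [lab [w [[h1 h2 h3] h4]]] := hmin.
have [b hb hw] := boundary_word hp h3.
have [q [hq hfill]] := peel_fill h1 h2 (full_disk D) hb hP.
have hqt := fill_trivial (bd_walk_fill h1 h2 hT hq).
have hsz : (size (map lab q) <= #|frontier A|)%N by rewrite size_map (size_bd_walk hq) hpT.
have [m hm hmB] := dehn_fill hqt hsz (hdehn p0).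
have nt := dehn_no_trivial p0 (hdehn p0).
have hAm : (#|A| <= m)%N.
  have := hfill _ hm; rewrite -hw => /(minimal_area_le nt h4).
  by move: hcard; rewrite hF /= cardsT /area; lia.
have hAp : (#|A|)%:R <= K * (#|frontier A|)%:R `^ alpha.
  by apply: le_trans hmB; rewrite ler_nat.
have hAn : (#|A|)%:R <= K * n%:R `^ alpha.
  apply: le_trans (minimal_area_le_dehn hpn (hdehn n0)).
  by rewrite ler_nat; apply: max_card.
have p0R : 0 < (#|frontier A|)%:R :> R by rewrite ltr0n.
have n0R : 0 < n%:R :> R by rewrite ltr0n.
move: hA; apply/negP; rewrite -leNgt /H.
have [hle|hlt] := leqP #|frontier A| n.
  apply: le_trans hAp _; rewrite powR_split // -!mulrA ler_wpM2l // (ler_wpM2r (ltW p0R)) //.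
  by apply: ge0_ler_powR; rewrite ?nnegrE ?subr_ge0 ?ler0n ?ler_nat.
apply: le_trans hAn _; rewrite powR_split // -!mulrA ler_wpM2l // ler_wpM2l ?powR_ge0 //.
by rewrite ler_nat ltnW.
Qed.

End Isoperimetry.

(** * Cheeger inequality *)

Section Cheeger.
Variables (R : realType) (D : disk_diagram).
Implicit Types (d : dart D) (v : vert D) (s : dface D) (U : {set vert D}).

Definition cut U : {set dart D} := [set d | (src d \in U) && (src (opp_dart d) \notin U)].

(** Passing from vertex sets to 2-cells: the star is large enough to contain
    all corners at [U], and its frontier stays close to the edge boundary of
    [U]. *)
Definition star_faces U : {set dface D} :=
  [set s | [exists d : dart D, (lface d == Some s) && (src d \in U)]].

Lemma vol_le_star U L : U \subset int_vertices D -> face_lengths_le D L ->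
  (\sum_(v in U) deg v <= L * #|star_faces U|)%N.
Proof.
move=> hU hL; rewrite vol_eq; apply: leq_trans (facing_le _ hL).
apply/subset_leq_card/subsetP => d; rewrite !inE => hd.
have [s hs] := int_not_bd (subsetP hU _ hd) erefl.
by rewrite /facing hs inE; apply/existsP; exists d; rewrite hs eqxx.
Qed.

(** A frontier edge of the star has no end in [U], so its 2-cell in the star
    has vertices in and out of [U]; walking around such a 2-cell one leaves
    [U] through an edge of the cut, which determines the 2-cell. *)
Lemma frontier_star_le U L : U \subset int_vertices D -> face_lengths_le D L ->
  (#|frontier (star_faces U)| <= L * #|cut U|)%N.
Proof.
move=> hU hL.
pose M := [set s in star_faces U | [exists d : dart D, (lface d == Some s) && (src d \notin U)]].
apply: (@leq_trans (L * #|M|)%N); last first.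
  rewrite leq_mul2l; apply/orP; right.
  rewrite -(card_imset M (@Some_inj _)).
  apply: leq_trans (leq_imset_card (@lface D) (mem (cut U))).
  apply/subset_leq_card/subsetP => o /imsetP[s]; rewrite inE => /andP[].
  rewrite inE => /existsP[d1 /andP[/eqP h1 u1]] /existsP[d2 /andP[/eqP h2 u2]] ->.
  have [n hn] : exists n, src (iter n (@fsucc D) d1) \notin U.
    have : lface d1 = lface d2 by rewrite h1 h2.
    by move/dd_faceP/iter_findex => h; exists (findex (@fsucc D) d1 d2); rewrite h.
  have hex : exists n, src (iter n (@fsucc D) d1) \notin U by exists n.
  case: (ex_minnP hex) => -[|k]; first by rewrite /= u1.
  move=> hk hmin; apply/imsetP; exists (iter k (@fsucc D) d1).
    rewrite !inE; move: hk; rewrite /= src_fsucc => ->; rewrite andbT.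
    by apply/negPn/negP => /hmin; rewrite ltnn.
  by rewrite lface_iter.
apply: leq_trans (facing_le _ hL); apply/subset_leq_card/subsetP => d.
rewrite !inE /facing; case E: (lface d) => [s|] // /andP[hs hn]; rewrite inE hs.
apply/existsP; exists d; rewrite E eqxx /=; apply/negP => hd.
have hsrc : src (fsucc (opp_dart d)) = src d by rewrite src_fsucc opp_dartK.
have [|s' hs'] := @int_not_bd D (src d) _ (fsucc (opp_dart d)) hsrc; first exact: (subsetP hU).
move: hn; rewrite -(lface_fsucc (opp_dart d)) hs' inE => /negP; apply.
by apply/existsP; exists (fsucc (opp_dart d)); rewrite hs' eqxx hsrc.
Qed.

Lemma cut_sum U : (#|cut U| = \sum_(e : edge D)
  ((src (e, true) \in U) != (src (e, false) \in U)))%N.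
Proof.
transitivity (\sum_(e : edge D) \sum_(o : bool) ((e, o) \in cut U : nat))%N.
  rewrite pair_bigA /= -sum1_card big_mkcond /=.
  by apply: eq_bigr => -[e o] _; case: (_ \in _).
apply: eq_bigr => e _; rewrite big_bool !inE /opp_dart /=.
by case: (_ \in U); case: (_ \in U).
Qed.

(** The layer-cake formula, by induction on the support: subtracting the least
    positive value from [g] on its support changes both sides by the
    isoperimetric inequality for the support. *)
Lemma coarea (h : R) (g : vert D -> R) : 0 <= h ->
  (forall U, U \subset int_vertices D -> (\sum_(v in U) deg v)%:R <= h * (#|cut U|)%:R) ->
  (forall v, 0 <= g v) -> (forall v, v \notin int_vertices D -> g v = 0) ->
  \sum_(v in int_vertices D) (deg v)%:R * g v <= h * \sum_(e : edge D) `|edge_diff g e|.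
Proof.
move=> h0 hU; have [n] := ubnP #|[set v | g v != 0]|; elim: n g => // n IH g hn g0 gint.
set U := [set v | g v != 0] in hn.
have UI : U \subset int_vertices D.
  by apply/subsetP => v; rewrite inE; apply: contraNT => /gint ->.
have [U0|/set0Pn[v0 hv0]] := eqVneq U set0.
  rewrite big1 ?mulr_ge0 ?sumr_ge0 // => v _.
  have : v \notin U by rewrite U0 inE.
  by rewrite inE negbK => /eqP ->; rewrite mulr0.
(* The level [mu] is the least positive value of [g]. *)
have [v1 hv1 hmin] : exists2 v1, v1 \in U & forall v, v \in U -> g v1 <= g v.
  by case: (@Order.TotalTheory.arg_minP _ _ _ v0 (mem U) g hv0) => v1 *; exists v1.
pose mu := g v1; have mu0 : 0 < mu by move: hv1; rewrite inE lt_neqAle eq_sym g0 andbT.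
pose g' v := if v \in U then g v - mu else 0.
have gU v : v \notin U -> g v = 0 by rewrite inE negbK => /eqP.
have Hg v : g v = g' v + mu * (v \in U)%:R.
  by rewrite /g'; case: (boolP (v \in U)) => [_|/gU ->]; rewrite ?mulr1 ?mulr0 ?subrK ?addr0.
have g'0 v : 0 <= g' v by rewrite /g'; case: ifP => // /hmin; rewrite subr_ge0.
have hlt : (#|[set v | g' v != 0%R]| < n)%N.
  apply: (@leq_trans #|U|); last by rewrite -ltnS.
  apply: proper_card; apply/properP; split.
    by apply/subsetP => v; rewrite inE /g'; case: ifP => //; rewrite eqxx.
  by exists v1 => //; rewrite inE /g' hv1 subrr eqxx.
have g'int v : v \notin int_vertices D -> g' v = 0.
  by move=> hv; rewrite /g'; case: ifP => // /(subsetP UI); rewrite (negbTE hv).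
have hIH := IH g' hlt g'0 g'int.
have -> : \sum_(v in int_vertices D) (deg v)%:R * g v =
    \sum_(v in int_vertices D) (deg v)%:R * g' v + mu * (\sum_(v in U) deg v)%:R.
  rewrite natr_sum mulr_sumr [X in _ + X]big_mkcond /=.
  rewrite [X in _ + X](_ : _ = \sum_(v in int_vertices D) (deg v)%:R * (mu * (v \in U)%:R)).
    by rewrite -big_split; apply: eq_bigr => v _ /=; rewrite -mulrDr -Hg.
  rewrite [RHS]big_mkcond /=; apply: eq_bigr => v _.
  have [hv|hv] := boolP (v \in U); last by case: ifP; rewrite ?mulr0.
  by rewrite (subsetP UI) // mulr1 mulrC.
have -> : \sum_(e : edge D) `|edge_diff g e| =
    \sum_(e : edge D) `|edge_diff g' e| + mu * (#|cut U|)%:R.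
  rewrite cut_sum natr_sum mulr_sumr -big_split; apply: eq_bigr => e _ /=.
  rewrite /edge_diff !Hg; move: (g'0 (src (e, true))) (g'0 (src (e, false))).
  rewrite /g'; case: (src (e, true) \in U); case: (src (e, false) \in U) => /= a1 a2.
  - by rewrite !(mulr1, mulr0, addr0); congr `|_|; ring.
  - by rewrite !(mulr1, mulr0, addr0, subr0) !ger0_norm // addr_ge0 // ltW.
  - by rewrite !(mulr1, mulr0, addr0, add0r, sub0r, normrN) !ger0_norm // addr_ge0 // ltW.
  - by rewrite !(mulr0, addr0).
rewrite mulrDr lerD // mulrCA (ler_wpM2l (ltW mu0)) //; exact: hU.
Qed.

(** Apply the coarea inequality to [f ^+ 2], and split [f x ^+ 2 - f y ^+ 2]
    as a product before Cauchy-Schwarz. *)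
Lemma cheeger (h : R) (f : vert D -> R) : 0 < h ->
  (forall U, U \subset int_vertices D -> (\sum_(v in U) deg v)%:R <= h * (#|cut U|)%:R) ->
  (forall v, v \notin int_vertices D -> f v = 0) -> (exists v, f v != 0) ->
  (h ^+ 2 *+ 2)^-1 * weighted_mass f <= dirichlet_energy f.
Proof.
move=> h0 hU fint fnz; have m0 := weighted_mass_gt0 fint fnz.
have E0 : 0 <= dirichlet_energy f by apply: sumr_ge0 => e _; apply: sqr_ge0.
set S := \sum_(e : edge D) `|edge_diff (fun v => f v ^+ 2) e|.
have S0 : 0 <= S by apply: sumr_ge0.
have hS : weighted_mass f <= h * S.
  apply: (coarea (ltW h0) hU) => v; first exact: sqr_ge0.
  by move/fint ->; rewrite expr0n.
have hmass : \sum_(e : edge D) (f (src (e, true)) ^+ 2 + f (src (e, false)) ^+ 2) = weighted_mass f.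
  rewrite /weighted_mass (eq_bigr (fun e => \sum_(o : bool) f (src (e, o)) ^+ 2)); last first.
    by move=> e _; rewrite big_bool.
  rewrite (pair_big xpredT xpredT (fun e o => f (src (e, o)) ^+ 2)) /=.
  rewrite (partition_big (@src D) xpredT) //= [RHS]big_mkcond /=; apply: eq_bigr => v _.
  transitivity (\sum_(d : dart D | src d == v) f v ^+ 2).
    apply: eq_big => [[e o]|[e o] /= /eqP ->] //.
  rewrite sumr_const; case: ifP => hv; last by rewrite fint ?hv // expr2 mul0r mul0rn.
  rewrite -[LHS]mulr_natl.
  by congr (_%:R * _); apply: eq_card => d; rewrite inE.
have hCS : S ^+ 2 <= dirichlet_energy f * (weighted_mass f *+ 2).
  have -> : S = \sum_(e : edge D) `|edge_diff f e| * `|f (src (e, true)) + f (src (e, false))|.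
    by apply: eq_bigr => e _; rewrite -normrM /edge_diff subr_sqr.
  apply: le_trans (cauchy_schwarz_sum _ _ _) _; apply: ler_pM; try by apply: sumr_ge0 => e _; apply: sqr_ge0.
    by apply: ler_sum => e _; rewrite real_normK ?num_real.
  rewrite -hmass -sumrMnl; apply: ler_sum => e _; rewrite real_normK ?num_real //.
  set a := f _; set c := f _; have := sqr_ge0 (a - c); nra.
have h1 : weighted_mass f ^+ 2 <= (h ^+ 2 *+ 2 * dirichlet_energy f) * weighted_mass f.
  apply: (@le_trans _ _ ((h * S) ^+ 2)).
    by rewrite ler_pXn2r // nnegrE; [exact: ltW | exact: mulr_ge0 (ltW h0) S0].
  rewrite exprMn; apply: le_trans (ler_wpM2l (sqr_ge0 h) hCS) _.
  by rewrite le_eqVlt; apply/orP; left; apply/eqP; ring.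
move: h1; rewrite expr2 ler_pM2r // => h1.
by rewrite mulrC ler_pdivrMr 1?mulrC // pmulrn_lgt0 // exprn_gt0.
Qed.

End Cheeger.

(** * The spectral estimates *)

(** Turns a lower bound for the eigenvalue by a negative power of the filling
    length into a lower bound for the filling length. *)
Lemma power_inversion (R : realType) (beta c lam N : R) : 0 < beta -> 0 < c -> 0 < N ->
  c / N `^ beta <= lam -> c `^ (1 / beta) * lam `^ (- (1 / beta)) <= N.
Proof.
move=> b0 c0 N0; have Nb : 0 < N `^ beta by apply: powR_gt0.
rewrite ler_pdivrMr // => hle.
have lam0 : 0 < lam.
  by rewrite -(pmulr_lgt0 _ Nb); apply: lt_le_trans hle.
rewrite powRN ler_pdivrMr ?powR_gt0 // [leRHS]mulrC.
have -> : lam `^ (1 / beta) * N = (lam * N `^ beta) `^ (1 / beta).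
  rewrite powRM ?(ltW lam0) ?(ltW Nb) // -powRrM.
  by rewrite mul1r divff ?gt_eqF // powRr1 // ltW.
have r0 : 0 <= 1 / beta by rewrite divr_ge0 // ltW.
by apply: (ge0_ler_powR r0) => //; rewrite nnegrE ltW // mulr_gt0.
Qed.

Lemma dehn_boundW (R : realType) (P : presentation) (K K' alpha : R) : K <= K' ->
  dehn_bound P K alpha -> dehn_bound P K' alpha.
Proof.
move=> hK h n hn; apply: le_trans (h n hn) _.
by rewrite lee_fin ler_wpM2r // powR_ge0.
Qed.

Lemma lambda1_ge_dehn (R : realType) (P : presentation) (D : disk_diagram) (b : vert D)
    (L : nat) (K alpha : R) :
  0 < K -> 1 <= alpha -> int_vertices D != set0 -> face_lengths_le D L ->
  bd_vertex b -> area_minimising R P D -> dehn_bound P K alpha ->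
  (L.+1%:R * K)^-1 / (filling_length b)%:R `^ (alpha + 1) <= lambda1 R D.
Proof.
move=> K0 a1 hi hL hb hm hd; have FL0 := filling_length_gt0 hi hb.
have FL0R : 0 < (filling_length b)%:R :> R by rewrite ltr0n.
have hp : (0 < perimeter (full_subcx D) <= filling_length b)%N.
  by rewrite perimeter_full_gt0 // perimeter_le_filling_length.
have hA := minimal_area_le_dehn hm hp (hd _ FL0).
apply: le_trans (lambda1_ge_filling_length_area R hi hL hb); rewrite -invfM.
have A0 : 0 < (area D)%:R :> R by rewrite ltr0n area_gt0.
rewrite lef_pV2 ?posrE ?mulr_gt0 ?powR_gt0 ?ltr0Sn //.
have -> : (filling_length b)%:R `^ (alpha + 1) = (filling_length b)%:R `^ alpha * (filling_length b)%:R :> R.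
  rewrite powRD; last by apply/implyP => _; rewrite gt_eqF.
  by rewrite (powRr1 (ltW FL0R)).
rewrite -!mulrA ler_wpM2l //.
apply: (@le_trans _ _ ((filling_length b)%:R * (K * (filling_length b)%:R `^ alpha))).
  by rewrite ler_wpM2l // ltW.
by rewrite le_eqVlt; apply/orP; left; apply/eqP; ring.
Qed.

Lemma lambda1_ge_cheeger (R : realType) (P : presentation) (D : disk_diagram) (b : vert D)
    (L : nat) (K alpha : R) :
  0 < K -> 1 <= alpha -> int_vertices D != set0 -> face_lengths_le D L ->
  bd_vertex b -> area_minimising R P D -> dehn_bound P K alpha ->
  ((L.+1%:R ^+ 2 * K) ^+ 2 *+ 2)^-1 / (filling_length b)%:R `^ (2 * alpha - 2) <= lambda1 R D.
Proof.
move=> K0 a1 hi hL hb hm hd; have FL0 := filling_length_gt0 hi hb.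
have FL0R : 0 < (filling_length b)%:R :> R by rewrite ltr0n.
have hp : (0 < perimeter (full_subcx D) <= filling_length b)%N.
  by rewrite perimeter_full_gt0 // perimeter_le_filling_length.
have hL' : face_lengths_le D L.+1 by move=> s; apply: leqW.
set N := (filling_length b)%:R : R.
pose H := K * N `^ (alpha - 1); have H0 : 0 < H by rewrite mulr_gt0 // powR_gt0.
pose h := L.+1%:R ^+ 2 * H; have h0 : 0 < h by rewrite mulr_gt0 // exprn_gt0 // ltr0Sn.
have hU (U : {set vert D}) : U \subset int_vertices D -> (\sum_(v in U) deg v)%:R <= h * (#|cut U|)%:R.
  move=> UI; apply: (@le_trans _ _ (L.+1%:R * (#|star_faces U|)%:R)).
    by rewrite -natrM ler_nat vol_le_star.
  apply: (@le_trans _ _ (L.+1%:R * (H * (#|frontier (star_faces U)|)%:R))).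
    rewrite ler_wpM2l //; exact: (linear_isoperimetry hm (ltW K0) a1 hd).
  apply: (@le_trans _ _ (L.+1%:R * (H * (L.+1%:R * (#|cut U|)%:R)))).
    by rewrite ler_wpM2l // (ler_wpM2l (ltW H0)) // -natrM ler_nat frontier_star_le.
  by rewrite le_eqVlt /h; apply/orP; left; apply/eqP; ring.
have -> : ((L.+1%:R ^+ 2 * K) ^+ 2 *+ 2)^-1 / N `^ (2 * alpha - 2) = (h ^+ 2 *+ 2)^-1.
  rewrite -invfM; congr (_^-1).
(* The Cheeger constant is of order [N `^ (1 - alpha)], and it is squared. *)
  have -> : 2 * alpha - 2 = (alpha - 1) * 2%:R by ring.
  rewrite powRrM powR_mulrn ?powR_ge0 // /h /H; ring.
apply: lambda1_lb => // f f1 f2; exact: cheeger.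
Qed.

Unset Implicit Arguments.

Theorem theorem2 (R : realType) (Lmax : nat) :
  exists c : R, 0 < c /\
  [/\ (* (i) *)
      forall (D : disk_diagram) (b : vert D),
        int_vertices D != finset.set0 -> face_lengths_le D Lmax -> bd_vertex b ->
        c / lambda1 R D <= (filling_length b)%:R * (area D)%:R,
      (* (ii), first claim *)
      forall (P : presentation) (D : disk_diagram) (b : vert D),
        int_vertices D != finset.set0 -> face_lengths_le D Lmax -> bd_vertex b ->
        max_relator_length P = Lmax -> area_minimising R P D ->
        ((c / lambda1 R D)%:E <=
           ((filling_length b)%:R)%:E * dehn R P (filling_length b))%E,
      (* (ii), second claim *)
      forall K alpha : R, 1 <= alpha ->
        exists C : R, 0 < C /\
        forall (P : presentation) (D : disk_diagram) (b : vert D),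
          int_vertices D != finset.set0 -> face_lengths_le D Lmax -> bd_vertex b ->
          max_relator_length P = Lmax -> area_minimising R P D ->
          dehn_bound P K alpha ->
          C * lambda1 R D `^ (- (1 / (alpha + 1))) <= (filling_length b)%:R
    & (* (iii) *)
      forall K alpha : R, 1 < alpha ->
        exists C : R, 0 < C /\
        forall (P : presentation) (D : disk_diagram) (b : vert D),
          int_vertices D != finset.set0 -> face_lengths_le D Lmax -> bd_vertex b ->
          max_relator_length P = Lmax -> area_minimising R P D ->
          dehn_bound P K alpha ->
          C * lambda1 R D `^ (- (1 / (2 * alpha - 2))) <= (filling_length b)%:R].
Proof.
have c0 : 0 < (Lmax.+1%:R)^-1 :> R by rewrite invr_gt0 ltr0Sn.
have partI (D : disk_diagram) (b : vert D) :
    int_vertices D != finset.set0 -> face_lengths_le D Lmax -> bd_vertex b ->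
    (Lmax.+1%:R)^-1 / lambda1 R D <= (filling_length b)%:R * (area D)%:R.
  move=> hi hL hb; have := lambda1_ge_filling_length_area R hi hL hb.
  have FA0 : 0 < (filling_length b)%:R * (area D)%:R :> R.
    by rewrite mulr_gt0 // ltr0n ?filling_length_gt0 ?area_gt0.
  rewrite invfM => hle; have l0 : 0 < lambda1 R D.
    by apply: lt_le_trans hle; rewrite mulr_gt0 // invr_gt0.
  by rewrite ler_pdivrMr // mulrC -ler_pdivrMr.
(* [K] may be replaced by any larger constant, in particular a positive one. *)
have K'0 (K : R) : 0 < `|K| + 1 by rewrite ltr_wpDl.
have KK' (K : R) : K <= `|K| + 1 by apply: le_trans (ler_norm K) _; rewrite lerDl.
exists (Lmax.+1%:R)^-1; split=> //; split=> //.
- move=> P D b hi hL hb _ hm; have hI := partI D b hi hL hb.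
  have FL0 : 0 < (filling_length b)%:R :> R by rewrite ltr0n filling_length_gt0.
  have hp : (0 < perimeter (full_subcx D) <= filling_length b)%N.
    by rewrite perimeter_full_gt0 // perimeter_le_filling_length.
  case E: (dehn R P (filling_length b)) => [B| |].
  + rewrite -EFinM lee_fin; apply: le_trans hI _; rewrite (ler_wpM2l (ltW FL0)) //.
    by apply: (minimal_area_le_dehn hm hp); rewrite E.
  + by rewrite gt0_muley ?lte_fin // leey.
(* The value -oo is impossible: it would bound the area by a negative number. *)
  + have : (area D)%:R <= -1 :> R by apply: (minimal_area_le_dehn hm hp); rewrite E leNye.
    by rewrite leNgt (lt_le_trans _ (ler0n _ _)) // ltrN10.
- move=> K alpha a1; exists ((Lmax.+1%:R * (`|K| + 1))^-1 `^ (1 / (alpha + 1))).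
  have C0 : 0 < (Lmax.+1%:R * (`|K| + 1))^-1 by rewrite invr_gt0 mulr_gt0 // ltr0Sn.
  split=> [|P D b hi hL hb _ hm hd]; first exact: powR_gt0.
  apply: power_inversion => //; [lra | by rewrite ltr0n filling_length_gt0 |].
  exact: (lambda1_ge_dehn (K'0 K) a1 hi hL hb hm (dehn_boundW (KK' K) hd)).
- move=> K alpha a1.
  exists (((Lmax.+1%:R ^+ 2 * (`|K| + 1)) ^+ 2 *+ 2)^-1 `^ (1 / (2 * alpha - 2))).
  have C0 : 0 < ((Lmax.+1%:R ^+ 2 * (`|K| + 1)) ^+ 2 *+ 2)^-1.
    by rewrite invr_gt0 pmulrn_lgt0 // exprn_gt0 // mulr_gt0 // exprn_gt0 // ltr0Sn.
  split=> [|P D b hi hL hb _ hm hd]; first exact: powR_gt0.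
  apply: power_inversion => //; [lra | by rewrite ltr0n filling_length_gt0 |].
  exact: (lambda1_ge_cheeger (K'0 K) (ltW a1) hi hL hb hm (dehn_boundW (KK' K) hd)).
Qed.
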